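(* Let $D$ be a smoothly bounded Jordan domain and let $f$ be an analytic function on $D$ such that $f'(D)\subset R(m,M)$ for some $0<m<M<\infty$. Then $\lambda_1(\mathcal{I}(f))=0$.
   Context: A smoothly bounded Jordan domain is a bounded domain in $\mathbb{C}$ whose boundary is a $C^\infty$ (regularly parametrized) Jordan curve. $R(m,M)=\{z\in\mathbb{C}: m<|z|<M\}$. $\lambda_1$ denotes 1-dimensional (Hausdorff) measure on subsets of $\mathbb{C}$. For an analytic function $f$ on a domain $D$, $\mathcal{I}(f)$ is the set of infinite valence values of $f$: the set of $w\in f(D)$ for which $f^{-1}(w)=\{z\in D: f(z)=w\}$ is infinite. *)

(* Defs.v *)
From HB Require Import structures.
From mathcomp Require Import all_boot all_order all_algebra.
From mathcomp Require Import all_classical all_reals all_analysis.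
From mathcomp Require Import complex.
Set Implicit Arguments.
Unset Strict Implicit.
Unset Printing Implicit Defensive.
Import Order.TTheory GRing.Theory Num.Theory.
Import numFieldNormedType.Exports.
Local Open Scope classical_set_scope.
Local Open Scope ring_scope.
Local Open Scope complex_scope.

(* [R[i]^o] is [R[i]] with its topology as a normed module over itself, so
   [derivable] and [derive1] at this type are complex differentiability and the
   complex derivative. The norm [`|z|] of [R[i]] is itself an element of [R[i]]
   (with zero imaginary part); [cabs] is the same norm as an element of [R]. *)
Definition cabs (R : realType) (z : R[i]) : R := complex.Re `|z|.

Definition boundary (T : topologicalType) (A : set T) : set T :=
  closure A `\` interior A.

Definition is_domain (R : realType) (D : set R[i]^o) : Prop :=
  [/\ D !=set0, open D & connected D].

Definition smooth (R : realType) (g : R -> R) : Prop :=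
  forall (n : nat) (t : R), derivable (derive1n n g) t 1.

(* A curve is parametrized by a 1-periodic function on the line, so that it is
   smooth at the closing point as well. *)
Definition smooth_jordan_param (R : realType) (g : R -> R[i]^o) : Prop :=
  let x := fun t => complex.Re (g t) in
  let y := fun t => complex.Im (g t) in
  [/\ smooth x /\ smooth y,
      forall t, g (t + 1) = g t,
      {in `[0, 1[ &, injective g} &
      forall t, (derive1 x t) +i* (derive1 y t) != 0].

Definition smooth_jordan_curve (R : realType) (J : set R[i]^o) : Prop :=
  exists2 g : R -> R[i]^o, smooth_jordan_param g & J = range g.

Definition smoothly_bounded_jordan_domain (R : realType) (D : set R[i]^o) :
    Prop :=
  [/\ is_domain D, bounded_set D & smooth_jordan_curve (boundary D)].

Definition analytic_on (R : realType) (D : set R[i]^o) (f : R[i]^o -> R[i]^o) :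
    Prop :=
  forall z, D z -> derivable f z 1.

Definition annulus (R : realType) (m M : R) : set R[i]^o :=
  [set z | m < cabs z < M].

Definition infinite_valence_values (R : realType) (D : set R[i]^o)
    (f : R[i]^o -> R[i]^o) : set R[i]^o :=
  [set w | (f @` D) w /\ infinite_set (D `&` f @^-1` [set w])].

Local Open Scope ereal_scope.

(* The value 0 is adjoined so that the empty set has diameter 0, not -oo. *)
Definition diam (R : realType) (A : set R[i]^o) : \bar R :=
  ereal_sup (0 |` [set (cabs (z.1 - z.2))%:E | z in A `*` A]).

Definition delta_cover (R : realType) (d : R) (A : set R[i]^o)
    (U : nat -> set R[i]^o) : Prop :=
  A `<=` \bigcup_i U i /\ forall i, diam (U i) <= d%:E.

Definition hausdorff1_delta (R : realType) (d : R) (A : set R[i]^o) : \bar R :=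
  ereal_inf [set \sum_(0 <= i <oo) diam (U i) | U in delta_cover d A].

Definition hausdorff1 (R : realType) (A : set R[i]^o) : \bar R :=
  ereal_sup [set hausdorff1_delta d A | d in [set d : R | (0 < d)%R]].

(* Main.v *)
(* The boundary value g of f along the boundary curve is Lipschitz, because f'
   is bounded; by Rademacher's theorem it is differentiable along the curve
   outside a null set of parameters, and a Lipschitz map sends that null set to
   a set of linear measure zero. At a parameter of differentiability, comparing
   f with the affine map having the same tangential derivative and applying a
   two-constants estimate to the difference shows that f is differentiable, in
   the full sense, at the boundary point z0. If f took the value f(z0) at points
   z of D tending to z0, the derivative at z0 would vanish, and Cauchy's
   estimate near those z would make f'(z) small, contradicting |f'| > m.
   Finally, as f' has no zero, an infinite fibre of f can only accumulate at the
   boundary, so its value is the boundary value at a point of the null set.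

   Locally the boundary is, after a rotation, the graph of a Lipschitz function
   phi; the two thin strips on either side of the graph avoid the boundary, so
   each of them lies in D or is disjoint from it. This replaces the Jordan curve
   theorem: nothing needs to be known about which side is inside. *)
From HB Require Import structures.
Require Import Defs.
From mathcomp Require Import all_boot all_order all_algebra.
From mathcomp Require Import all_classical all_reals all_analysis.
From mathcomp Require Import measurable_realfun complex.
From mathcomp Require Import ring lra.
Set Implicit Arguments.
Unset Strict Implicit.
Unset Printing Implicit Defensive.
Import Order.TTheory GRing.Theory Num.Theory.
Import numFieldNormedType.Exports.
Local Open Scope classical_set_scope.
Local Open Scope ring_scope.
Local Open Scope complex_scope.

(** * The modulus and the complex derivative *)

(** No integral formula for holomorphic functions enters. The analytic input is that the mean of
    [Re G] over a circle does not depend on the radius: its radial derivative is, up to a factor,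
    the integral over a period of the angular derivative of [Im G]. Since [f'] is bounded but not
    known to be continuous, the fundamental theorem of calculus is needed for bounded derivatives.
    It comes out of the same one-dimensional Rademacher theorem that yields the exceptional null
    set, and that theorem is obtained from Radon-Nikodym: a Lipschitz function plus a steep linear
    one is monotone, and its Stieltjes measure is dominated by Lebesgue measure. The harmonic
    measure of the two-constants estimate is replaced by powers of a quadratic polynomial whose
    modulus is at most slightly above 1 on the flat side of a half disc, and smaller on the arc than
    near the centre. The power is fixed before the scale, so one choice serves at all distances from
    [z0]. As [f] is only given inside, the estimate is made above the graph lifted by a small
    amount. *)

Section cabs_theory.
Variable R : realType.
Implicit Types z w : R[i].

Lemma cabsE z : cabs z = Num.sqrt ((complex.Re z) ^+ 2 + (complex.Im z) ^+ 2).
Proof. by case: z => a b; rewrite /cabs normc_def. Qed.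

Lemma normC_cabs z : `|z| = (cabs z)%:C.
Proof. by rewrite cabsE normc_def. Qed.

Lemma cabs_ge0 z : 0 <= cabs z.
Proof. by rewrite cabsE sqrtr_ge0. Qed.

Lemma cabs_sqr z : cabs z ^+ 2 = (complex.Re z) ^+ 2 + (complex.Im z) ^+ 2.
Proof. by rewrite cabsE sqr_sqrtr// addr_ge0 ?sqr_ge0. Qed.

Lemma cabsM z w : cabs (z * w) = cabs z * cabs w.
Proof. by apply: complexI; rewrite rmorphM/= -!normC_cabs normrM. Qed.

Lemma cabsX z n : cabs (z ^+ n) = cabs z ^+ n.
Proof. by apply: complexI; rewrite rmorphXn/= -!normC_cabs normrX. Qed.

Lemma cabsV z : cabs (z^-1) = (cabs z)^-1.
Proof. by apply: complexI; rewrite fmorphV/= -!normC_cabs normfV. Qed.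

Lemma cabsN z : cabs (- z) = cabs z.
Proof. by apply: complexI; rewrite -!normC_cabs normrN. Qed.

Lemma cabsD z w : cabs (z + w) <= cabs z + cabs w.
Proof. by rewrite -lecR rmorphD/= -!normC_cabs ler_normD. Qed.

Lemma cabsB z w : cabs (z - w) = cabs (w - z).
Proof. by rewrite -cabsN opprB. Qed.

Lemma cabs0 : cabs (0 : R[i]) = 0.
Proof. by apply: complexI; rewrite -normC_cabs normr0. Qed.

Lemma cabs_eq0 z : (cabs z == 0) = (z == 0).
Proof. by rewrite -(inj_eq (@complexI R)) -normC_cabs normr_eq0. Qed.

Lemma cabs_gt0 z : (0 < cabs z) = (z != 0).
Proof. by rewrite lt_def cabs_ge0 andbT cabs_eq0. Qed.

Lemma cabs_real (x : R) : cabs x%:C = `|x|.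
Proof. by rewrite cabsE/= expr0n/= addr0 sqrtr_sqr. Qed.

Lemma cabs_conj z : cabs z^*%C = cabs z.
Proof. by case: z => a b; rewrite !cabsE/= sqrrN. Qed.

Lemma Re_le_cabs z : `|complex.Re z| <= cabs z.
Proof.
by rewrite cabsE -sqrtr_sqr ler_wsqrtr// lerDl sqr_ge0.
Qed.

Lemma Im_le_cabs z : `|complex.Im z| <= cabs z.
Proof.
by rewrite cabsE -sqrtr_sqr ler_wsqrtr// lerDr sqr_ge0.
Qed.

Lemma cabs_le_ReIm z : cabs z <= `|complex.Re z| + `|complex.Im z|.
Proof.
rewrite -(@ler_pXn2r _ 2) ?nnegrE ?cabs_ge0 ?addr_ge0//.
rewrite cabs_sqr sqrrD !real_normK ?num_real// -addrA lerD2l lerDr.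
by rewrite mulrn_wge0 ?mulr_ge0.
Qed.

Lemma cReD z w : complex.Re (z + w) = complex.Re z + complex.Re w.
Proof. by case: z w => ? ? []. Qed.
Lemma cImD z w : complex.Im (z + w) = complex.Im z + complex.Im w.
Proof. by case: z w => ? ? []. Qed.
Lemma cReN z : complex.Re (- z) = - complex.Re z.
Proof. by case: z. Qed.
Lemma cImN z : complex.Im (- z) = - complex.Im z.
Proof. by case: z. Qed.
Lemma cReM z w : complex.Re (z * w) =
  complex.Re z * complex.Re w - complex.Im z * complex.Im w.
Proof. by case: z w => ? ? []. Qed.
Lemma cImM z w : complex.Im (z * w) =
  complex.Re z * complex.Im w + complex.Im z * complex.Re w.
Proof. by case: z w => ? ? [? ?]; rewrite /= addrC. Qed.

Lemma cReMc z w : complex.Re (z^*%C * w) =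
  complex.Re z * complex.Re w + complex.Im z * complex.Im w.
Proof. by case: z w => ? ? [? ?]/=; rewrite mulNr opprK. Qed.

Lemma complex_eqP z w :
  complex.Re z = complex.Re w -> complex.Im z = complex.Im w -> z = w.
Proof. by case: z w => ? ? [? ?]/= -> ->. Qed.

End cabs_theory.

Section derive_eps.

(** Stated over a [numFieldType], so that real and complex derivatives share one division-free
    form. *)
Lemma is_derive_epsP (K : numFieldType) (f : K^o -> K^o) (x l : K^o) :
  is_derive x 1 f l <->
  forall e : K, 0 < e -> exists2 d : K, 0 < d &
    forall y, `|y - x| < d -> `|f y - f x - l * (y - x)| <= e * `|y - x|.
Proof.
split=> [[dfx <-] e e0|H].
- move: dfx => /cvg_ex[/= l' dl'].
  have -> : 'D_1 f x = l' by apply/cvg_lim.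
  move/cvgrPdist_le : dl' => /(_ e e0)[/= d d0 Hd].
  exists d => // y yxd.
  have [->|yx] := eqVneq y x; first by rewrite !subrr mulr0 subrr normr0 mulr0.
  have := Hd (y - x); rewrite /= sub0r normrN => /(_ yxd).
  rewrite subr_eq0 => /(_ yx).
  rewrite -[_ *: 1]/(_ * 1) mulr1 subrK => Hy.
  have yx0 : y - x != 0 by rewrite subr_eq0.
  rewrite -ler_pdivrMr ?normr_gt0// -normf_div.
  rewrite mulrBl mulfK// distrC -[_ / (y - x)]mulrC; exact: Hy.
- have cv : (fun h => h^-1 *: (f (h *: (1 : K^o) + x) - f x)) @ 0^' --> l.
    apply/cvgrPdist_le => /= e e0; have [d d0 Hd] := H e e0.
    exists d => //= h; rewrite /= sub0r normrN => hd h0.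
    have := Hd (h + x); rewrite addrK => /(_ hd) H1.
    rewrite -[_ *: 1]/(_ * 1) mulr1 -[_ *: _]/(_ * _).
    rewrite distrC -(@ler_pM2r _ `|h|) ?normr_gt0// -normrM mulrBl.
    by rewrite [X in X - _]mulrAC mulVf// mul1r.
  apply: DeriveDef; first by apply/cvg_ex; exists l.
  exact/cvg_lim.
Qed.

Variable R : realType.

Definition cderiv (G : R[i] -> R[i]) (z l : R[i]) : Prop :=
  is_derive (z : R[i]^o) 1 (G : R[i]^o -> R[i]^o) (l : R[i]^o).

(** Positivity in [R[i]] forces a zero imaginary part, so the tolerances [e] and [d] can be
    exchanged for elements of [R]. *)
Lemma cderivP (G : R[i] -> R[i]) (z l : R[i]) :
  cderiv G z l <->
  forall e : R, 0 < e -> exists2 d : R, 0 < d &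
    forall w, cabs (w - z) < d -> cabs (G w - G z - l * (w - z)) <= e * cabs (w - z).
Proof.
rewrite /cderiv is_derive_epsP; split => H e e0.
- have [|d d0 Hd] := H e%:C; first by rewrite ltcR.
  have := d0; rewrite ltcE /= => /andP[/eqP imd red].
  exists (complex.Re d) => // w wd.
  have dE : d = (complex.Re d)%:C by case: (d) imd => ? ? /= ->.
  have := Hd w; rewrite !normC_cabs dE ltcR => /(_ wd).
  by rewrite -rmorphM/= lecR.
- have e0' := e0; move: e0'; rewrite ltcE /= => /andP[/eqP ime ree].
  have eE : e = (complex.Re e)%:C by case: (e) ime => ? ? /= ->.
  have [d d0 Hd] := H _ ree.
  exists d%:C; first by rewrite ltcR.
  move=> w; rewrite !normC_cabs ltcR => /Hd.
  by rewrite eE -rmorphM/= lecR.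
Qed.

Lemma cderiv_derive1 (G : R[i]^o -> R[i]^o) (z : R[i]^o) :
  derivable G z 1 -> cderiv G z (derive1 G z).
Proof.
by move=> dG; apply: DeriveDef; [exact: dG|symmetry; exact: derive1E].
Qed.

(* [c] selects the component of [G]: 1 for the real and -i for the imaginary
   part. *)
Lemma is_derive_curve (G : R[i] -> R[i]) (p : R -> R[i]) (c l : R[i])
    (t a b : R) :
  is_derive t 1 (fun s => complex.Re (p s)) a ->
  is_derive t 1 (fun s => complex.Im (p s)) b ->
  cderiv G (p t) l ->
  is_derive t 1 (fun s => complex.Re (c * G (p s))) (complex.Re (c * l * (a +i* b))).
Proof.
move=> /is_derive_epsP Ha /is_derive_epsP Hb /cderivP HG.
apply/is_derive_epsP => e e0.
pose B := `|a| + `|b| + 2.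
have B0 : 0 < B by rewrite ltr_wpDl// addr_ge0.
pose C := cabs c + 1.
have C0 : 0 < C by rewrite ltr_wpDl// cabs_ge0.
pose L := cabs l + 1.
have L0 : 0 < L by rewrite ltr_wpDl// cabs_ge0.
(* The error of [G] contributes [C * e1 * B = e / 2], that of the curve [C * L * (2 * e2) = e / 2].
   The cap 1 in [e3] gives the crude bound [B * h] on the increment of [p]. *)
pose e1 := e / (2 * C * B).
have e10 : 0 < e1 by rewrite divr_gt0// !mulr_gt0.
pose e2 := e / (4 * C * L).
have e20 : 0 < e2 by rewrite divr_gt0// !mulr_gt0.
pose e3 := Num.min 1 e2.
have e30 : 0 < e3 by rewrite lt_min ltr01.
have [d1 d10 H1] := Ha _ e30; have [d2 d20 H2] := Hb _ e30.
have [d3 d30 H3] := HG _ e10.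
exists (Num.min (Num.min d1 d2) (d3 / B)).
  by rewrite !lt_min d10 d20 divr_gt0.
move=> s; rewrite !lt_min => /andP[/andP[s1 s2]]; rewrite ltr_pdivlMr// => s3.
set h := `|s - t| in s1 s2 s3 *.
have h0 : 0 <= h by rewrite /h.
have {}H1 := H1 s s1; have {}H2 := H2 s s2; rewrite -/h in H1 H2.
pose D := p s - p t - (s - t)%:C * (a +i* b).
have DE : cabs D <= 2 * e3 * h.
  apply: (le_trans (cabs_le_ReIm _)).
  have -> : complex.Re D = complex.Re (p s) - complex.Re (p t) - a * (s - t).
    by rewrite /D !(cReD, cReN, cReM)/= mul0r subr0 [(s - t) * a]mulrC.
  have -> : complex.Im D = complex.Im (p s) - complex.Im (p t) - b * (s - t).
    by rewrite /D !(cImD, cImN, cImM)/= mul0r addr0 [(s - t) * b]mulrC.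
  lra.
have e3le1 : e3 <= 1 by rewrite ge_min lexx.
have e3lee2 : e3 <= e2 by rewrite ge_min lexx orbT.
have pB : cabs (p s - p t) <= B * h.
  have -> : p s - p t = D + (s - t)%:C * (a +i* b) by rewrite /D; ring.
  apply: (le_trans (cabsD _ _)); rewrite cabsM cabs_real -/h.
  have := cabs_le_ReIm (a +i* b); rewrite /= => ab.
  apply: (@le_trans _ _ (2 * e3 * h + h * (`|a| + `|b|))).
    by apply: lerD => //; rewrite ler_wpM2l.
  rewrite /B; nra.
have H3' : cabs (G (p s) - G (p t) - l * (p s - p t)) <= e1 * (B * h).
  apply: (le_trans (H3 _ _)); last by rewrite ler_wpM2l// ltW.
  by apply: (le_lt_trans pB); rewrite mulrC.
have -> : complex.Re (c * G (p s)) - complex.Re (c * G (p t)) -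
    complex.Re (c * l * (a +i* b)) * (s - t) =
  complex.Re (c * ((G (p s) - G (p t) - l * (p s - p t)) + l * D)).
  have -> : (G (p s) - G (p t) - l * (p s - p t)) + l * D =
    G (p s) - G (p t) - l * ((s - t)%:C * (a +i* b)) by rewrite /D; ring.
  by rewrite !(cReD, cReN, cReM, cImD, cImN, cImM)/=; ring.
apply: (le_trans (Re_le_cabs _)); rewrite cabsM.
apply: (@le_trans _ _ (C * (e1 * (B * h) + L * (2 * e2 * h)))).
  apply: ler_pM; rewrite ?cabs_ge0//; first by rewrite /C lerDl.
  apply: (le_trans (cabsD _ _)); apply: lerD => //.
  rewrite cabsM; apply: ler_pM; rewrite ?cabs_ge0//; first by rewrite /L lerDl.
  by apply: (le_trans DE); rewrite ler_wpM2r// ler_wpM2l.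
rewrite le_eqVlt; apply/orP; left; apply/eqP.
rewrite /e1 /e2; field.
by rewrite !gt_eqF.
Qed.

End derive_eps.

(** * Lipschitz functions of a real variable *)

Section lipschitz_ftc.
Variable R : realType.
Local Notation mu := (@lebesgue_measure R).

(** Both sides are infima over the same covers by half-open intervals, so comparing interval lengths
    is enough, and [A] may be any set. *)
Lemma stieltjes_le_lebesgue (G : cumulative R R) (K : R) : 0 < K ->
  (forall x y, x <= y -> G y - G x <= K * (y - x)) ->
  forall A, (lebesgue_stieltjes_measure G A <= K%:E * mu A)%E.
Proof.
move=> K0 GL A; rewrite -lee_pdivrMl//.
apply: le_ereal_inf_tmp => _ [F [mF AF] <-].
rewrite lee_pdivrMl// -nneseriesZl; last first.
  by move=> i _; exact: (wlength_ge0 idfun).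
apply: (@le_trans _ _ (\sum_(0 <= k <oo) wlength G (F k))%E).
  by apply: ereal_inf_lbound; exists F.
apply: lee_nneseries => [k _ _|k _]; first exact: wlength_ge0.
change (wlength G (F k) <= K%:E * wlength (@idfun R) (F k))%E.
have /ocitvP[->|[x x12 ->]] := mF k.
  by rewrite !wlength0 mule0.
rewrite !wlength_itv_bnd; [exact/GL/ltW|exact: ltW..].
Qed.

Variables (g : R -> R) (K : R).
Hypothesis gL : forall x y, `|g x - g y| <= K * `|x - y|.

Lemma lipschitz_continuousR : continuous g.
Proof.
move=> x; apply/cvgrPdist_le => /= e e0.
near=> y; apply: (le_trans (gL _ _)).
have : `|x - y| < e / (`|K| + 1).
  near: y; apply: (@cvgr_dist_lt _ _ _ (nbhs x)); first exact: cvg_id.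
  by rewrite divr_gt0// ltr_wpDl.
rewrite ltr_pdivlMr ?ltr_wpDl// => /ltW; apply: le_trans.
rewrite mulrC ler_wpM2l//; apply: (le_trans (ler_norm _)); lra.
Unshelve. all: by end_near. Qed.

(** Rademacher's theorem on the line, with its integral form. The Radon-Nikodym density of a
    monotone modification of [g] is its derivative almost everywhere by Lebesgue's differentiation
    theorem. *)
Lemma lipschitz_FTC (a b : R) : a < b ->
  exists h : R -> R, [/\ mu.-integrable `]a, b] (EFin \o h),
    forall x, a <= x <= b -> g x - g a = \int[mu]_(t in `]a, x]) h t &
    {ae mu, forall x, a < x < b -> is_derive x 1 g (h x)}].
Proof.
move=> ab.
have K0 : 0 <= K.
  have := le_trans (normr_ge0 _) (gL b a).
  by rewrite pmulr_lge0// normr_gt0 subr_eq0 gt_eqF.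
(* With slope [K + 1] the upper Lipschitz constant [2 * K + 1] is positive even if [K = 0], as
   [stieltjes_le_lebesgue] demands. *)
pose G (x : R) := g x + (K + 1) * x.
have Glip x y : x <= y -> 0 <= G y - G x <= (2 * K + 1) * (y - x).
  move=> xy; have := gL y x; rewrite (@ger0_norm _ (y - x)) ?subr_ge0//.
  rewrite ler_norml => /andP[? ?]; rewrite /G; apply/andP; split; nra.
have Gnd : nondecreasing G by move=> x y /Glip/andP[+ _]; rewrite subr_ge0.
have Gc : continuous G.
  move=> x; apply: cvgD; first exact: lipschitz_continuousR.
  by apply: cvgM; [exact: cvg_cst|exact: cvg_id].
have Grc : right_continuous G by apply: right_continuousW.
pose Gm := isCumulative.Build R _ R G Gnd Grc.
pose GC : cumulative R R := HB.pack G Gm.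
pose nu0 := lebesgue_stieltjes_measure GC.
have nu0E x y : x <= y -> nu0 `]x, y]%classic = (G y - G x)%:E.
  move=> xy; rewrite /nu0 /lebesgue_stieltjes_measure/= /measure_extension.
  rewrite measurable_mu_extE; first by rewrite /= wlength_itv_bnd.
  exact: is_ocitv.
have mI : measurable (`]a, b]%classic : set (measurableTypeR R)).
  exact: measurable_itv.
have nuoo : (nu0 `]a, b]%classic < +oo)%E by rewrite nu0E ?ltW// ltry.
pose nu : {finite_measure set (measurableTypeR R) -> \bar R} := mfrestr mI nuoo.
have dom : nu `<< mu.
  move=> A A0 B mB BA.
  have B0 : mu B = 0%E by apply: A0.
  apply/eqP; rewrite eq_le measure_ge0 andbT /nu/= /mfrestr/= /mrestr.
  have H : (nu0 (B `&` `]a, b]%classic) <= (2 * K + 1)%:E * mu (B `&` `]a, b]%classic))%E.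
    apply: stieltjes_le_lebesgue; first by lra.
    by move=> x y /Glip/andP[].
  apply: (le_trans H).
  have -> : mu (B `&` `]a, b]%classic) = 0%E.
    by apply/eqP; rewrite eq_le measure_ge0 andbT -B0 le_measure// inE//; exact: measurableI.
  by rewrite mule0.
have [f [f0 ffin intf fE]] := radon_nikodym_sigma_finite dom.
pose F := fine \o f.
have FE x : (F x)%:E = f x by rewrite /F/= fineK.
have FEE : EFin \o F = f by apply/funext => x /=; rewrite FE.
have intF : mu.-integrable setT (EFin \o F) by rewrite FEE.
have GE x : a <= x <= b -> G x - G a = \int[mu]_(t in `]a, x]) F t.
  move=> /andP[ax xb]; rewrite /Rintegral.
  under eq_integral do rewrite FE.
  rewrite -fE; last exact: measurable_itv.
  rewrite /nu/= /mfrestr/= /mrestr.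
  have -> : `]a, x]%classic `&` `]a, b]%classic = `]a, x]%classic :> set R.
    apply/setIidl => y /=; rewrite !in_itv/= => /andP[->/= yx].
    exact: le_trans yx xb.
  have -> : lebesgue_stieltjes_measure GC = nu0 by [].
  by rewrite nu0E.
have intFi (i : interval R) : mu.-integrable [set` i] (EFin \o F).
  by apply: integrableS intF => //; exact: measurable_itv.
exists (fun x => F x - (K + 1)).
have intc x : mu.-integrable `]a, x] (EFin \o cst (K + 1)).
  have H : mu.-integrable `[a, x] (EFin \o cst (K + 1)).
    apply: continuous_compact_integrable; first exact: segment_compact.
    by apply: continuous_subspaceT => ?; exact: cvg_cst.
  apply: integrableS H; [exact: measurable_itv|exact: measurable_itv|].
  exact: subset_itv_oc_cc.
split.
- have H : mu.-integrable `]a, b] ((EFin \o F) \- (EFin \o cst (K + 1)%R))%E.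
    by apply: integrableB => //; exact: measurable_itv.
  by apply: eq_integrable H => //; exact: measurable_itv.
- move=> x axb.
  have mx : measurable (`]a, x]%classic : set (measurableTypeR R)).
    exact: measurable_itv.
  have -> : \int[mu]_(t in `]a, x]) (F t - (K + 1)) =
      \int[mu]_(t in `]a, x]) F t - \int[mu]_(t in `]a, x]) cst (K + 1) t.
    exact: (RintegralB mx (intFi _) (intc x)).
  rewrite -GE// Rintegral_cst//.
  have /andP[ax _] := axb.
  rewrite /= lebesgue_measure_itv/= lte_fin; case: ltP => ax'.
    by rewrite /G /=; ring.
  have -> : x = a by apply/eqP; rewrite eq_le ax ax'.
  by rewrite !subrr mulr0 subr0.
- have locF : locally_integrable [set: R] F.
    split; [| exact: openT|].
      by have /integrableP[/measurable_EFinP] := intF.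
    move=> Q _ cQ.
    have /integrableP[_] := intF; apply: le_lt_trans.
    apply: ge0_subset_integral => //; first exact: compact_measurable.
    apply: measurableT_comp => //; apply: measurableT_comp => //.
    by have /integrableP[/measurable_EFinP] := intF.
  have := @FTC1 R F (BRight a) (fun y => intFi _) locF.
  apply: filterS; first exact: (ae_filter_ringOfSetsType mu).
  move=> x H /andP[ax xb]; have {H}[dF F'x] := H ax.
  (* Near an interior point [G] differs from the indefinite integral of [F] by a constant, by
     [GE]. *)
  have dG : is_derive x 1 G (F x).
    have D : is_derive x 1 (fun y => \int[mu]_(t in `]a, y]) F t) (F x).
      by apply: (DeriveDef dF); rewrite -derive1E.
    have H : is_derive x 1 (fun y => G a + \int[mu]_(t in `]a, y]) F t) (F x).
      by rewrite -[X in is_derive _ _ _ X]add0r; apply: is_deriveD.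
    apply: near_eq_is_derive H.
    near=> y; rewrite -GE; first by rewrite addrC subrK.
    by apply/andP; split; apply/ltW; near: y; [exact: lt_nbhsr|exact: lt_nbhsl].
  rewrite (_ : g = G - (fun y => (K + 1) * y)); last first.
    by apply/funext => y; rewrite !fctE /G addrK.
  apply: is_deriveB.
  rewrite -[X in is_derive _ _ _ X]mulr1.
  exact: is_deriveZ.
Unshelve. all: by end_near. Qed.

End lipschitz_ftc.

(** * The maximum principle and the Cauchy estimate *)

Section mean_value.
Variable R : realType.
Local Notation mu := (@lebesgue_measure R).

Lemma is_derive_continuous (v : R -> R) (x l : R) :
  is_derive x 1 v l -> {for x, continuous v}.
Proof. by move=> [dv _]; exact/differentiable_continuous/derivable1_diffP. Qed.

Lemma mean_value_le (v dv : R -> R) (K a b : R) : a <= b ->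
  (forall t, a <= t <= b -> is_derive t 1 v (dv t)) ->
  (forall t, a <= t <= b -> dv t <= K) -> v b - v a <= K * (b - a).
Proof.
rewrite le_eqVlt => /orP[/eqP <- _ _|ab vD vK].
  by rewrite !subrr mulr0.
have [||c + ->] := @MVT _ v dv _ _ ab.
- move=> x; rewrite in_itv/= => /andP[/ltW ax /ltW xb]; apply: vD.
  by rewrite ax xb.
- apply: derivable_within_continuous => x; rewrite in_itv/= => axb.
  by have [] := vD _ axb.
- rewrite in_itv/= => /andP[/ltW ac /ltW cb].
  by rewrite ler_wpM2r ?subr_ge0 ?(ltW ab)//; apply: vK; rewrite ac.
Qed.

Lemma lipschitz_bounded_derivative (v dv : R -> R) (K : R) :
  (forall t : R, is_derive t 1 v (dv t)) -> (forall t, `|dv t| <= K) ->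
  forall x y, `|v x - v y| <= K * `|x - y|.
Proof.
move=> vD vK.
have H x y : y <= x -> `|v x - v y| <= K * (x - y).
  move=> yx; rewrite ler_norml; apply/andP; split.
    have := @mean_value_le (fun t => - v t) (fun t => - dv t) K _ _ yx.
    have D t : y <= t <= x -> is_derive t 1 (fun t => - v t) (- dv t).
      by move=> _; apply: is_deriveN.
    move=> /(_ D) H; have {H} := H _.
    have B t : y <= t <= x -> - dv t <= K.
      by move=> _; apply: le_trans (ler_norm _) _; rewrite normrN.
    by move=> /(_ B); lra.
  apply: (@mean_value_le v dv) => // t _.
  exact: le_trans (ler_norm _) (vK t).
move=> x y; have [yx|xy] := leP y x; first by rewrite (@ger0_norm _ (x - y)) ?subr_ge0// H.
rewrite distrC (distrC x) (@ger0_norm _ (y - x)) ?subr_ge0 ?(ltW xy)//.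
exact/H/ltW.
Qed.

(** [dv] is the pointwise limit of the continuous difference quotients [u n] of step
    [1 / (n + 1)]. *)
Lemma measurable_derivative (v dv : R -> R) :
  (forall t : R, is_derive t 1 v (dv t)) -> measurable_fun setT dv.
Proof.
move=> vD.
have vc : continuous v by move=> x; exact: is_derive_continuous (vD x).
pose u (n : nat) (t : R) := n.+1%:R * (v (t + n.+1%:R^-1) - v t).
apply: (@measurable_fun_cvg _ _ _ setT u) => [n|t _].
  apply: continuous_measurable_fun => t.
  apply: cvgM; first exact: cvg_cst.
  apply: cvgB; last exact: vc.
  apply: continuous_comp; last exact: vc.
  by apply: cvgD; [exact: cvg_id|exact: cvg_cst].
apply/cvgrPdist_le => /= e e0.
have /is_derive_epsP /(_ _ e0)[d d0 Hd] := vD t.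
near=> n.
have n0 : 0 < (n.+1%:R : R)^-1 by rewrite invr_gt0.
have := Hd (t + n.+1%:R^-1); rewrite [t + _]addrC addrK (gtr0_norm n0).
have -> : n.+1%:R^-1 < d by near: n; exact: near_infty_natSinv_lt (PosNum d0).
move=> /(_ isT).
rewrite -(@ler_pM2l _ n.+1%:R)// mulrCA mulfV// mulr1.
rewrite -{1}(@gtr0_norm _ n.+1%:R)// -normrM mulrBr mulrCA mulfV// mulr1.
by rewrite distrC /u [t + _]addrC.
Unshelve. all: by end_near. Qed.

(** [dv] may be discontinuous. The Lipschitz function [v] is the integral of the density given by
    [lipschitz_FTC], which agrees with [dv] almost everywhere by uniqueness of derivatives. *)
Lemma bounded_derivative_FTC (v dv : R -> R) (K a b : R) : a < b ->
  (forall t : R, is_derive t 1 v (dv t)) -> (forall t, `|dv t| <= K) ->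
  v b - v a = \int[mu]_(t in `]a, b]) dv t.
Proof.
move=> ab vD vK.
have [h [ih hE hD]] := lipschitz_FTC (lipschitz_bounded_derivative vD vK) ab.
rewrite hE; last by rewrite (ltW ab) lexx.
have mI : measurable (`]a, b]%classic : set (measurableTypeR R)).
  exact: measurable_itv.
congr fine; apply: ae_eq_integral => //.
- by have /integrableP[] := ih.
- apply/measurable_EFinP; apply: (@measurable_funS _ _ _ _ setT) => //.
  exact: measurable_derivative vD.
(* [lipschitz_FTC] differentiates on the open interval while the integral runs over []a, b]]: the
   point [b] is discarded as a null set. *)
- have nb : {ae mu, forall x, x <> b}.
    exists [set b]; split; [exact: measurable_set1|exact: lebesgue_measure_set1|].
    by move=> x /= /contrapT.
  apply: (@filterS2 _ _ (ae_filter_ringOfSetsType mu) _ _ _ _ hD nb).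
  move=> x H xb /=; rewrite in_itv/= => /andP[ax xb'].
  have [|_ <-] := H; first by rewrite ax lt_neqAle xb' andbT; apply/eqP.
  by have [_ <-] := vD x.
Qed.

End mean_value.

(** * Constancy of circle means and a weak maximum principle *)

Section weak_maximum.
Variable R : realType.
Local Notation mu := (@lebesgue_measure R).
Local Notation T2 := (pi *+ 2 : R).
Variables (G dG : R[i] -> R[i]) (z0 : R[i]) (rho : R).
Hypothesis GD : forall z : R[i], 0 < cabs (z - z0) < rho -> cderiv G z (dG z).
Hypothesis GB : forall s : R, 0 < s -> exists C : R, forall z : R[i],
  s < cabs (z - z0) < rho -> cabs (dG z) <= C.

Let e t : R[i] := cos t +i* sin t.
Let p r t : R[i] := z0 + r%:C * e t.

Let cabs_e t : cabs (e t) = 1.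
Proof. by rewrite cabsE/= cos2Dsin2 sqrtr1. Qed.

Let cabs_p r t : cabs (p r t - z0) = `|r|.
Proof. by rewrite /p addrC addKr cabsM cabs_e mulr1 cabs_real. Qed.

Let u r t := complex.Re (G (p r t)).
Let D r t := complex.Re (dG (p r t) * e t).

Let u_r (r t : R) : 0 < r < rho -> is_derive r 1 (u ^~ t) (D r t).
Proof.
move=> /andP[r0 rr].
have -> : u^~ t = fun r => complex.Re (1 * G (p r t)).
  by apply/funext => s; rewrite mul1r.
have -> : D r t = complex.Re (1 * dG (p r t) * (cos t +i* sin t)) by rewrite mul1r.
apply: (@is_derive_curve _ G (fun r => p r t)).
- have -> : (fun s => complex.Re (p s t)) = cst (complex.Re z0) + (cos t \*: id).
    by apply/funext => s; rewrite !fctE /p !(cReD, cReM)/= mul0r subr0 mulrC.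
  rewrite -[X in is_derive _ _ _ X]add0r; apply: is_deriveD.
  by rewrite -[X in is_derive _ _ _ X]mulr1; apply: is_deriveZ.
- have -> : (fun s => complex.Im (p s t)) = cst (complex.Im z0) + (sin t \*: id).
    by apply/funext => s; rewrite !fctE /p !(cImD, cImM)/= mul0r addr0 mulrC.
  rewrite -[X in is_derive _ _ _ X]add0r; apply: is_deriveD.
  by rewrite -[X in is_derive _ _ _ X]mulr1; apply: is_deriveZ.
- by apply: GD; rewrite cabs_p gtr0_norm// r0.
Qed.

(** The factor [c] is used twice: 1 gives continuity of [u r], and [- 'i] gives the conjugate
    function [Im G]. *)
Let G_t (c : R[i]) (r t : R) : 0 < r < rho ->
  is_derive t 1 (fun t : R => complex.Re (c * G (p r t)))
    (complex.Re (c * dG (p r t) * (r%:C * ('i%C * e t)))).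
Proof.
move=> /andP[r0 rr].
have -> : r%:C * ('i%C * e t) = (- r * sin t) +i* (r * cos t).
  by apply: complex_eqP; rewrite /e/=; ring.
apply: (@is_derive_curve _ G (fun t => p r t)).
- have -> : (fun s => complex.Re (p r s)) = cst (complex.Re z0) + (r \*: cos).
    by apply/funext => s; rewrite !fctE /p !(cReD, cReM)/= mul0r subr0.
  rewrite -[X in is_derive _ _ _ X]add0r; apply: is_deriveD.
  by rewrite mulNr -mulrN; apply: is_deriveZ.
- have -> : (fun s => complex.Im (p r s)) = cst (complex.Im z0) + (r \*: sin).
    by apply/funext => s; rewrite !fctE /p !(cImD, cImM)/= mul0r addr0.
  rewrite -[X in is_derive _ _ _ X]add0r; apply: is_deriveD.
- by apply: GD; rewrite cabs_p gtr0_norm// r0.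
Qed.

Let T20 : 0 < T2. Proof. by rewrite pmulrn_lgt0// pi_gt0. Qed.

Let mI : measurable (`]0, T2]%classic : set (measurableTypeR R)).
Proof. exact: measurable_itv. Qed.

Let integrable_cont (v : R -> R) : continuous v -> mu.-integrable `]0, T2] (EFin \o v).
Proof.
move=> vc.
have H : mu.-integrable `[0, T2] (EFin \o v).
  apply: continuous_compact_integrable; first exact: segment_compact.
  exact: continuous_subspaceT.
apply: integrableS H; [exact: measurable_itv|exact: measurable_itv|].
exact: subset_itv_oc_cc.
Qed.

Let integrable_u (r : R) : 0 < r < rho -> mu.-integrable `]0, T2] (EFin \o u r).
Proof.
move=> rr; apply: integrable_cont => t.
have := is_derive_continuous (G_t 1 t rr).
rewrite (_ : (fun _ => _) = u r)//.
by apply/funext => s; rewrite mul1r.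
Qed.

Let circ r := \int[mu]_(t in `]0, T2]) u r t.

(** By the Cauchy-Riemann relation in polar form, [r * D r t] is the derivative in [t] of [Im G]
    along the circle, which takes equal values at 0 and [T2]. *)
Let int_D0 (r : R) : 0 < r < rho -> \int[mu]_(t in `]0, T2]) D r t = 0.
Proof.
move=> rr; have /andP[r0 rrho] := rr.
have r20 : 0 < r / 2 by rewrite divr_gt0.
have [C HC] := GB r20.
pose v t := complex.Re (- 'i%C * G (p r t)).
have vD (t : R) : is_derive t 1 v (r * D r t).
  rewrite /v /D.
  have := G_t (- 'i%C) t rr.
  have -> : - 'i%C * dG (p r t) * (r%:C * ('i%C * e t)) = r%:C * (dG (p r t) * e t).
    transitivity (- ('i%C ^+ 2) * (r%:C * (dG (p r t) * e t))); first by ring.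
    by rewrite sqr_i opprK mul1r.
  by rewrite cReM/= mul0r subr0.
have DC (t : R) : `|D r t| <= C.
  apply: (le_trans (Re_le_cabs _)); rewrite cabsM cabs_e mulr1.
  apply: HC; rewrite cabs_p gtr0_norm// rrho andbT.
  by rewrite ltr_pdivrMr// ltr_pMr// ltr1n.
have vB (t : R) : `|r * D r t| <= r * C by rewrite normrM gtr0_norm// ler_wpM2l// ltW.
have := bounded_derivative_FTC T20 vD vB.
have mD : measurable_fun setT (D r).
  have -> : D r = (fun t => r^-1 * (r * D r t)).
    by apply/funext => t; rewrite mulKf// gt_eqF.
  by apply: measurable_funM => //; exact: measurable_derivative vD.
rewrite RintegralZl//; last first.
  apply: (@le_integrable _ _ _ mu _ mI _ (EFin \o cst C)).
  - by apply/measurable_EFinP; apply: measurable_funS mD.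
  - by move=> t _ /=; rewrite lee_fin; apply: (le_trans (DC t)); exact: ler_norm.
  - by apply: integrable_cont => ?; exact: cvg_cst.
have -> : v T2 - v 0 = 0.
  by rewrite /v /p /e cos2pi sin2pi cos0 sin0 subrr.
by move/esym/eqP; rewrite mulf_eq0 gt_eqF//= => /eqP.
Qed.

(** The derivative passes under the integral because [GB] bounds [dG] on the annulus of inner radius
    [r / 2]; [int_D0] then makes it vanish. *)
Let circ_D (r : R) : 0 < r < rho -> is_derive r 1 circ 0.
Proof.
move=> rr; have /andP[r0 rrho] := rr.
have r20 : 0 < r / 2 by rewrite divr_gt0.
have [C HC] := GB r20.
have Ir : (`]r / 2, rho[%classic : set R) r.
  by rewrite /= in_itv/= rrho andbT ltr_pdivrMr// ltr_pMr// ltr1n.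
have I0 x : (`]r / 2, rho[%classic : set R) x -> 0 < x < rho.
  by rewrite /= in_itv/= => /andP[rx ->]; rewrite andbT (lt_trans r20).
have dE (x y : R) : (`]r / 2, rho[%classic : set R) x -> partial1of2 u x y = D x y.
  by move=> /I0 /(u_r y) [_ <-]; rewrite partial1of2E.
have uint x : (`]r / 2, rho[%classic : set R) x -> mu.-integrable `]0, T2] (EFin \o u x).
  by move=> /I0; exact: integrable_u.
have uder (x y : R) : (`]r / 2, rho[%classic : set R) x -> `]0, T2]%classic y ->
    derivable (u ^~ y) x 1.
  by move=> /I0 /(u_r y) [].
have C0 : 0 <= C.
  apply: le_trans (cabs_ge0 _) (HC (p r 0) _); rewrite cabs_p (gtr0_norm r0).
  by have := Ir; rewrite /= in_itv/=.
have Cint : mu.-integrable `]0, T2] (EFin \o cst C).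
  by apply: integrable_cont => ?; exact: cvg_cst.
have ub (x y : R) : (`]r / 2, rho[%classic : set R) x -> `]0, T2]%classic y ->
    `|partial1of2 u x y| <= cst C y.
  move=> Ix _; rewrite dE//; apply: (le_trans (Re_le_cabs _)).
  rewrite cabsM cabs_e mulr1; apply: HC; rewrite cabs_p.
  by have /andP[x0 _] := I0 _ Ix; rewrite gtr0_norm//; move: Ix; rewrite /= in_itv/=.
have dC := @derivable_under_integral R _ _ mu u _ mI r _ _ Ir uint uder _ (fun=> C0) Cint ub.
have EC := @differentiation_under_integral R _ _ mu u _ mI r _ _ Ir uint uder _ (fun=> C0) Cint ub.
apply: DeriveDef; first exact: dC.
rewrite -derive1E [LHS]EC -[RHS](int_D0 rr); apply: eq_Rintegral => y _.
by rewrite dE.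
Qed.

Let circ_const (r s : R) : 0 < r -> r < s -> s < rho -> circ r = circ s.
Proof.
move=> r0 rs srho.
have H (x : R) : r <= x <= s -> 0 < x < rho.
  by move=> /andP[rx xs]; rewrite (lt_le_trans r0 rx) (le_lt_trans xs srho).
have [||c _] := @MVT _ circ (fun=> 0) _ _ rs.
- move=> x; rewrite in_itv/= => /andP[/ltW rx /ltW xs]; apply: circ_D.
  by apply: H; rewrite rx xs.
- apply: derivable_within_continuous => x; rewrite in_itv/= => /H/circ_D.
  by case.
- by rewrite mul0r => /eqP; rewrite subr_eq0 => /eqP.
Qed.

(** The circle integrals at radius [r] and at a tiny radius [q] agree, and the latter is nearly [T2]
    times the value at the centre. Allowing a loss [d] makes a single [q] enough; at [z0] itself
    only continuity is asked of [G]. *)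
Lemma weak_maximum (r d : R) : 0 < r < rho -> 0 < d ->
  (forall e : R, 0 < e -> exists2 d : R, 0 < d &
    forall z : R[i], cabs (z - z0) < d -> cabs (G z - G z0) <= e) ->
  exists z, cabs (z - z0) = r /\ complex.Re (G z0) - d < complex.Re (G z).
Proof.
move=> /andP[r0 rrho] d0 Gc.
apply: contrapT => H.
have uH (t : R) : u r t <= complex.Re (G z0) - d.
  rewrite leNgt; apply/negP => H1; apply: H; exists (p r t); split => //.
  by rewrite cabs_p gtr0_norm.
have d20 : 0 < d / 2 by rewrite divr_gt0.
have [s s0 Hs] := Gc _ d20.
pose q := Num.min (s / 2) (r / 2).
have q0 : 0 < q by rewrite lt_min !divr_gt0.
have qs : q < s by rewrite gt_min ltr_pdivrMr// ltr_pMr// ltr1n.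
have qr : q < r by rewrite gt_min [X in _ || X]ltr_pdivrMr// ltr_pMr// ltr1n orbT.
have E := circ_const q0 qr rrho.
have L1 : circ r <= (complex.Re (G z0) - d) * T2.
  have -> : (complex.Re (G z0) - d) * T2 =
      \int[mu]_(t in `]0, T2]) (cst (complex.Re (G z0) - d) t).
    rewrite Rintegral_cst//= lebesgue_measure_itv/= lte_fin T20/=.
    by rewrite subr0.
  apply: le_Rintegral => //; first by apply: integrable_u; rewrite r0.
  by apply: integrable_cont => ?; exact: cvg_cst.
have L2 : (complex.Re (G z0) - d / 2) * T2 <= circ q.
  have -> : (complex.Re (G z0) - d / 2) * T2 =
      \int[mu]_(t in `]0, T2]) (cst (complex.Re (G z0) - d / 2) t).
    rewrite Rintegral_cst//= lebesgue_measure_itv/= lte_fin T20/=.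
    by rewrite subr0.
  apply: le_Rintegral => //.
  - by apply: integrable_cont => ?; exact: cvg_cst.
  - by apply: integrable_u; rewrite q0 (lt_trans qr).
  - move=> t _ /=; rewrite /u lerBlDr -lerBlDl.
    have := Hs (p q t); rewrite cabs_p gtr0_norm// => /(_ qs) Hq.
    have := le_trans (Re_le_cabs _) Hq; rewrite cReD cReN distrC.
    exact: le_trans (ler_norm _).
have := le_trans L2 (_ : _ <= (complex.Re (G z0) - d) * T2).
by rewrite E => /(_ L1); rewrite ler_pM2r//; lra.
Qed.

End weak_maximum.

(** * Complex derivatives and their estimates *)

Section complex_derivatives.
Variable R : realType.
Implicit Types (G f g : R[i] -> R[i]) (z w l m : R[i]).

Lemma cderivD f g z l m : cderiv f z l -> cderiv g z m ->
  cderiv (fun w => f w + g w) z (l + m).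
Proof. by move=> lf mg; exact: is_deriveD. Qed.

Lemma cderivM f g z l m : cderiv f z l -> cderiv g z m ->
  cderiv (fun w => f w * g w) z (f z * m + g z * l).
Proof. by move=> lf mg; exact: (is_deriveM lf mg). Qed.

Lemma cderiv_cst (c z : R[i]) : cderiv (fun _ => c) z 0.
Proof. exact: is_derive_cst. Qed.

Lemma cderiv_id z : cderiv (fun w => w) z 1.
Proof. exact: is_derive_id. Qed.

Lemma cderiv_eq f g z l m : (forall w, f w = g w) -> l = m ->
  cderiv f z l -> cderiv g z m.
Proof. by move=> /funext -> ->. Qed.

Lemma cderiv_near f g z l (d : R) : 0 < d ->
  (forall w, cabs (w - z) < d -> f w = g w) -> cderiv f z l -> cderiv g z l.
Proof.
move=> d0 fg /cderivP H; apply/cderivP => e e0; have [s s0 Hs] := H e e0.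
exists (Num.min d s); first by rewrite lt_min d0.
move=> w; rewrite lt_min => /andP[wd /Hs]; rewrite fg// fg//.
by rewrite subrr cabs0.
Qed.

Lemma cderiv_inv z : z != 0 ->
  cderiv (fun w => w^-1) z (- z ^- 2).
Proof.
move=> z0; apply/cderivP => e e0.
have az : 0 < cabs z by rewrite cabs_gt0.
pose A := cabs z.
(* As [|w| >= A / 2], the error [|w - z| ^ 2 / (|w| * A ^ 2)] is at most
   [2 * |w - z| ^ 2 / A ^ 3]. *)
exists (Num.min (A / 2) (e * A ^+ 3 / 2)).
  by rewrite lt_min !divr_gt0// mulr_gt0// exprn_gt0.
move=> w; rewrite lt_min => /andP[w1 w2].
have wA : A / 2 <= cabs w.
  have := cabsD w (z - w); rewrite addrC subrK (cabsB z) -/A; lra.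
have w0 : w != 0 by rewrite -cabs_gt0 (lt_le_trans _ wA)// divr_gt0.
have -> : w^-1 - z^-1 - - z ^- 2 * (w - z) = (w - z) ^+ 2 * (w^-1 * z ^- 2).
  by field; rewrite z0 w0.
rewrite cabsM cabsX cabsM !cabsV cabsX -/A expr2 -mulrA [leRHS]mulrC.
rewrite ler_wpM2l ?cabs_ge0//.
rewrite mulrA ler_pdivrMr ?exprn_gt0// ler_pdivrMr; last first.
  by rewrite (lt_le_trans _ wA)// divr_gt0.
apply: (le_trans (ltW w2)).
apply: (@le_trans _ _ (e * A ^+ 2 * (A / 2))).
  by rewrite !exprS expr0; nra.
by rewrite ler_wpM2l// mulr_ge0 ?exprn_ge0 ?ltW.
Qed.

Lemma cderiv_cvg f z l : cderiv f z l ->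
  forall e : R, 0 < e -> exists2 d : R, 0 < d &
    forall w, cabs (w - z) < d -> cabs (f w - f z) <= e.
Proof.
move=> /cderivP H e e0; have [d d0 Hd] := H _ ltr01.
have C0 : 0 < cabs l + 1 by rewrite ltr_wpDl ?cabs_ge0.
exists (Num.min d (e / (cabs l + 1))); first by rewrite lt_min d0 divr_gt0.
move=> w; rewrite lt_min ltr_pdivlMr// => /andP[/Hd H1 H2].
have -> : f w - f z = (f w - f z - l * (w - z)) + l * (w - z) by ring.
apply: (le_trans (cabsD _ _)); apply: le_trans (ltW H2).
by rewrite cabsM; lra.
Qed.

(** The real mean value theorem is applied to the projection [v] of [G] onto the direction of the
    total increment [D]; the increment of [v] is [cabs D ^ 2]. *)
Lemma cabs_curve_le G (p l : R -> R[i]) (a b : R -> R) (V s t : R) : s <= t ->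
  (forall x : R, s <= x <= t -> is_derive x 1 (fun y => complex.Re (p y)) (a x)) ->
  (forall x : R, s <= x <= t -> is_derive x 1 (fun y => complex.Im (p y)) (b x)) ->
  (forall x : R, s <= x <= t -> cderiv G (p x) (l x)) ->
  (forall x : R, s <= x <= t -> cabs (l x * (a x +i* b x)) <= V) ->
  cabs (G (p t) - G (p s)) <= V * (t - s).
Proof.
move=> st Ha Hb HG HV; set D := G (p t) - G (p s).
pose v x := complex.Re (D^*%C * G (p x)).
have vD x : s <= x <= t ->
    is_derive x 1 v (complex.Re (D^*%C * l x * (a x +i* b x))).
  by move=> sx; apply: is_derive_curve; [exact: Ha|exact: Hb|exact: HG].
have := @mean_value_le R v _ (cabs D * V) _ _ st vD.
have B x : s <= x <= t -> complex.Re (D^*%C * l x * (a x +i* b x)) <= cabs D * V.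
  move=> sx; apply: le_trans (ler_norm _) _; apply: (le_trans (Re_le_cabs _)).
  by rewrite -mulrA cabsM cabs_conj ler_wpM2l ?cabs_ge0// HV.
move=> /(_ B).
have -> : v t - v s = cabs D ^+ 2.
  have -> : v t - v s = complex.Re (D^*%C * D).
    by rewrite /v {3}/D mulrBr cReD cReN.
  by rewrite cReMc cabs_sqr !expr2.
have [->|D0] := eqVneq (cabs D) 0.
  move=> _; apply: mulr_ge0; last by rewrite subr_ge0.
  by apply: le_trans (cabs_ge0 _) (HV s _); rewrite lexx.
by rewrite expr2 -mulrA ler_pM2l// lt_def D0 cabs_ge0.
Qed.

Lemma cabs_segment_le G (dG : R[i] -> R[i]) (M : R) (z w : R[i]) :
  (forall t : R, 0 <= t <= 1 -> cderiv G (z + t%:C * (w - z))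
    (dG (z + t%:C * (w - z)))) ->
  (forall t : R, 0 <= t <= 1 -> cabs (dG (z + t%:C * (w - z))) <= M) ->
  cabs (G w - G z) <= M * cabs (w - z).
Proof.
move=> HG HM; pose p t := z + t%:C * (w - z).
have p1 : p 1 = w by rewrite /p mul1r addrC subrK.
have p0 : p 0 = z by rewrite /p mul0r addr0.
suff : cabs (G (p 1) - G (p 0)) <= (M * cabs (w - z)) * (1 - 0).
  by rewrite p1 p0 subr0 mulr1.
apply: (@cabs_curve_le G p (fun t => dG (p t)) (fun=> complex.Re (w - z))
  (fun=> complex.Im (w - z))) => // t t01.
- have -> : (fun y => complex.Re (p y)) = cst (complex.Re z) + (complex.Re (w - z) \*: id).
    by apply/funext => s; rewrite !fctE /p !(cReD, cReM)/= mul0r subr0 mulrC.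
  rewrite -[X in is_derive _ _ _ X]add0r; apply: is_deriveD.
  by rewrite -[X in is_derive _ _ _ X]mulr1; apply: is_deriveZ.
- have -> : (fun y => complex.Im (p y)) = cst (complex.Im z) + (complex.Im (w - z) \*: id).
    by apply/funext => s; rewrite !fctE /p !(cImD, cImM)/= mul0r addr0 mulrC.
  rewrite -[X in is_derive _ _ _ X]add0r; apply: is_deriveD.
  by rewrite -[X in is_derive _ _ _ X]mulr1; apply: is_deriveZ.
- have -> : complex.Re (w - z) +i* complex.Im (w - z) = w - z by case: (w - z).
  by rewrite cabsM ler_wpM2r ?cabs_ge0// HM.
Qed.

(* The difference quotient of [h] at [z1], completed by [h' z1], is only known
   to be holomorphic off [z1]; [weak_maximum] allows that. *)
Lemma cauchy_estimate (h dh : R[i] -> R[i]) (z1 : R[i]) (rho r C S : R) :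
  0 < r < rho -> 0 <= S ->
  (forall z, cabs (z - z1) < rho -> cderiv h z (dh z)) ->
  (forall z, cabs (z - z1) < rho -> cabs (dh z) <= C) ->
  (forall z, cabs (z - z1) < rho -> cabs (h z - h z1) <= C * cabs (z - z1)) ->
  (forall z, cabs (z - z1) = r -> cabs (h z - h z1) <= S) ->
  cabs (dh z1) * r <= S.
Proof.
move=> /andP[r0 rrho] S0 hD dhC hL hS.
have rho0 : 0 < rho by exact: lt_trans rrho.
have zz : cabs (z1 - z1) < rho by rewrite subrr cabs0.
have C0 : 0 <= C by apply: le_trans (cabs_ge0 _) (dhC _ zz).
(* This factor turns the value of the quotient at [z1] into [cabs (dh z1) ^ 2], so bounding a real
   part bounds the modulus of [dh z1]. *)
set c := (dh z1)^*%C.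
pose k z := if z == z1 then dh z1 else (h z - h z1) * (z - z1)^-1.
pose G z := c * k z.
pose dG z := c * ((h z - h z1) * (- (z - z1) ^- 2) + (z - z1)^-1 * dh z).
have GD z : 0 < cabs (z - z1) < rho -> cderiv G z (dG z).
  move=> /andP[z0 zr].
  have zz1 : z - z1 != 0 by rewrite -cabs_gt0.
  have H1 : cderiv (fun w => h w - h z1) z (dh z).
    by have := cderivD (hD z zr) (cderiv_cst (- h z1) z); rewrite addr0.
  have H2 : cderiv (fun w => (w - z1)^-1) z (- (z - z1) ^- 2).
    have := cderiv_inv zz1 => /cderivP Hi.
    apply/cderivP => e e0; have [d d0 Hd] := Hi e e0; exists d => // w wd.
    have := Hd (w - z1); have -> : w - z1 - (z - z1) = w - z by ring.
    by move=> /(_ wd).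
  have := cderivM (cderiv_cst c z) (cderivM H1 H2); rewrite mulr0 addr0.
  apply: (cderiv_near z0) => w wz; rewrite /G /k.
  have [E|//] := eqVneq w z1.
  by move: wz; rewrite E cabsB ltxx.
have GB s : 0 < s -> exists C : R, forall z : R[i],
    s < cabs (z - z1) < rho -> cabs (dG z) <= C.
  move=> s0; exists (cabs c * (C * rho / s ^+ 2 + s^-1 * C)) => z /andP[sz zr].
  have z0 : 0 < cabs (z - z1) by exact: lt_trans sz.
  rewrite cabsM ler_wpM2l ?cabs_ge0//; apply: (le_trans (cabsD _ _)); apply: lerD.
    rewrite cabsM cabsN cabsV cabsX; apply: ler_pM.
    - exact: cabs_ge0.
    - by rewrite invr_ge0 exprn_ge0 ?cabs_ge0.
    - by apply: le_trans (hL _ zr) _; rewrite ler_wpM2l// ltW.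
    - by rewrite lef_pV2 ?posrE ?exprn_gt0// lerXn2r ?nnegrE ?(ltW s0) ?cabs_ge0// ltW.
  rewrite cabsM cabsV; apply: ler_pM; rewrite ?cabs_ge0 ?invr_ge0 ?cabs_ge0//.
    by rewrite lef_pV2 ?posrE// ltW.
  exact: dhC.
have Gc e : 0 < e -> exists2 d : R, 0 < d &
    forall z : R[i], cabs (z - z1) < d -> cabs (G z - G z1) <= e.
  move=> e0; have c1 : 0 < cabs c + 1 by rewrite ltr_wpDl ?cabs_ge0.
  have e1 : 0 < e / (cabs c + 1) by rewrite divr_gt0.
  have /cderivP /(_ _ e1)[d d0 Hd] := hD _ zz.
  exists d => // z zd; rewrite /G -mulrBr cabsM /k eqxx.
  have [_|zz1] := eqVneq z z1; first by rewrite subrr cabs0 mulr0 ltW.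
  have z0 : 0 < cabs (z - z1) by rewrite cabs_gt0 subr_eq0.
  have E : (h z - h z1) * (z - z1)^-1 - dh z1 = (h z - h z1 - dh z1 * (z - z1)) * (z - z1)^-1.
    by field; rewrite subr_eq0.
  have H : cabs ((h z - h z1) * (z - z1)^-1 - dh z1) <= e / (cabs c + 1).
    by rewrite E cabsM cabsV ler_pdivrMr//; exact: Hd.
  apply: (@le_trans _ _ ((cabs c + 1) * (e / (cabs c + 1)))).
    by apply: ler_pM; rewrite ?cabs_ge0// lerDl.
  by rewrite mulrCA mulfV ?mulr1// gt_eqF.
have rr : 0 < r < rho by rewrite r0.
have G1 : complex.Re (G z1) = cabs (dh z1) ^+ 2.
  by rewrite /G /k eqxx cReMc cabs_sqr !expr2.
(* On the circle the quotient is at most [S / r] in modulus, and somewhere there the real part of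
   [G] is within [d] of its central value. *)
have key d : 0 < d -> cabs (dh z1) ^+ 2 - d <= cabs (dh z1) * (S / r).
  move=> d0; have [z [zr]] := weak_maximum GD GB rr d0 Gc.
  rewrite G1 => /ltW H; apply: (le_trans H).
  apply: le_trans (ler_norm _) _; apply: (le_trans (Re_le_cabs _)).
  rewrite /G cabsM cabs_conj ler_wpM2l ?cabs_ge0// /k.
  have zz1 : z != z1 by rewrite -subr_eq0 -cabs_gt0 zr.
  by rewrite (negbTE zz1) cabsM cabsV zr ler_wpM2r ?invr_ge0 ?(ltW r0)// hS.
have [->|dh0] := eqVneq (cabs (dh z1)) 0; first by rewrite mul0r.
have dhp : 0 < cabs (dh z1) by rewrite lt_def dh0 cabs_ge0.
rewrite -ler_pdivlMr// -(ler_pM2l dhp) -expr2.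
apply/ler_addgt0Pr => e e0; rewrite -lerBlDr; exact: key.
Qed.

(** [Phi], the squared modulus of [H] plus a small multiple of [|z| ^ 2], attains its maximum on
    [K]. At an interior maximum the strict convexity of the added term pays for the loss in
    [weak_maximum]. Coordinates in [R * R] are used because closed boxes are compact there. *)
Lemma maximum_principle (H dH : R[i] -> R[i]) (K : set (R * R)) (B N C : R) :
  compact K -> 0 <= B ->
  (forall p, K p -> cderiv H (p.1 +i* p.2) (dH (p.1 +i* p.2))) ->
  (forall p, K p -> cabs (dH (p.1 +i* p.2)) <= C) ->
  (forall p, K p -> cabs (p.1 +i* p.2) <= N) ->
  (forall p, K p -> cabs (H (p.1 +i* p.2)) <= B \/
    exists2 rho, 0 < rho & forall z, cabs (z - (p.1 +i* p.2)) < rho ->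
      K (complex.Re z, complex.Im z)) ->
  forall p, K p -> cabs (H (p.1 +i* p.2)) <= B.
Proof.
move=> cK B0 HD dHC KN Kb p0 Kp0; rewrite leNgt; apply/negP => HB.
have N0 : 0 <= N by apply: le_trans (cabs_ge0 _) (KN _ Kp0).
pose c (p : R * R) := p.1 +i* p.2.
have HDc p : K p -> cderiv H (c p) (dH (c p)) := HD p.
rewrite -/(c p0) in HB.
(* Small enough that the added term, at most [e * N ^ 2] on [K], cannot raise [B ^ 2] to the squared
   modulus at [p0]. *)
pose e := (cabs (H (c p0)) ^+ 2 - B ^+ 2) / (2 * (N ^+ 2 + 1)).
have N1 : 0 < 2 * (N ^+ 2 + 1) by rewrite mulr_gt0// ltr_wpDl// sqr_ge0.
have e0 : 0 < e.
  rewrite divr_gt0// subr_gt0 ltr_pXn2r ?nnegrE ?cabs_ge0//.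
have eN : B ^+ 2 + e * N ^+ 2 < cabs (H (c p0)) ^+ 2.
  have : e * (2 * (N ^+ 2 + 1)) = cabs (H (c p0)) ^+ 2 - B ^+ 2.
    by rewrite /e mulfVK// gt_eqF.
  have := sqr_ge0 N; nra.
pose Phi p := cabs (H (c p)) ^+ 2 + e * cabs (c p) ^+ 2.
have HRI p : K p -> {for p, continuous (fun q => complex.Re (H (c q)))} /\
    {for p, continuous (fun q => complex.Im (H (c q)))}.
  move=> Kp; have Hc := cderiv_cvg (HDc _ Kp).
  have near_c d : 0 < d -> \forall q \near p, cabs (c q - c p) < d.
    move=> d0; have d20 : 0 < d / 2 by rewrite divr_gt0.
    have n1 : \forall q \near p, `|p.1 - q.1| < d / 2.
      by apply: (@cvgr_dist_lt _ _ _ (nbhs p) _ (fun q => q.1)) => //; exact: cvg_fst.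
    have n2 : \forall q \near p, `|p.2 - q.2| < d / 2.
      by apply: (@cvgr_dist_lt _ _ _ (nbhs p) _ (fun q => q.2)) => //; exact: cvg_snd.
    apply: filterS2 n1 n2 => q q1 q2; apply: (le_lt_trans (cabs_le_ReIm _)).
    by rewrite /c/= distrC (distrC q.2); lra.
  split; apply/cvgrPdist_le => /= d d0; have [s s0 Hs] := Hc d d0.
    apply: filterS (near_c s s0) => q /Hs; rewrite distrC.
    by apply: le_trans; rewrite -cReN -cReD; exact: Re_le_cabs.
  apply: filterS (near_c s s0) => q /Hs; rewrite distrC.
  by apply: le_trans; rewrite -cImN -cImD; exact: Im_le_cabs.
have Phic : {within K, continuous Phi}.
  apply: continuous_in_subspaceT => p; rewrite inE => Kp.
  have [Hr Hi] := HRI _ Kp.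
  have -> : Phi = (fun q => complex.Re (H (c q)) * complex.Re (H (c q))
      + complex.Im (H (c q)) * complex.Im (H (c q)) + e * (q.1 * q.1 + q.2 * q.2)).
    by apply/funext => q; rewrite /Phi !cabs_sqr !expr2.
  apply: cvgD; first by apply: cvgD; apply: cvgM.
  apply: cvgM; first exact: cvg_cst.
  by apply: cvgD; apply: cvgM; (exact: cvg_fst || exact: cvg_snd).
have K0 : K !=set0 by exists p0.
have [q Kq qmax] := compact_EVT_max K0 cK Phic.
rewrite inE in Kq.
have q0 : Phi p0 <= Phi q by apply: qmax; rewrite inE.
have [Hq|[rho rho0 Hrho]] := Kb _ Kq.
  have : Phi q <= B ^+ 2 + e * N ^+ 2.
    rewrite /Phi lerD// ?ler_wpM2l ?(ltW e0)// lerXn2r ?nnegrE ?cabs_ge0//.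
    exact: KN.
  have : cabs (H (c p0)) ^+ 2 <= Phi p0.
    by rewrite /Phi lerDl mulr_ge0 ?sqr_ge0 ?ltW.
  lra.
pose zq := c q.
have cE z : c (complex.Re z, complex.Im z) = z by case: z.
(* [Re (G z) - Re (G zq)] is the part of the increment of [Phi] that is linear in the increments of
   [H] and of [z]. The remainder is [|H z - H zq| ^ 2 + e * |z - zq| ^ 2], and its last term equals
   the loss [e * (rho / 2) ^ 2] on the circle. *)
pose G z := 2%:C * (H zq)^*%C * H z + 2%:C * e%:C * zq^*%C * z.
pose dG z := 2%:C * (H zq)^*%C * dH z + 2%:C * e%:C * zq^*%C.
have GD z : cabs (z - zq) < rho -> cderiv G z (dG z).
  move=> zr; have Kz := Hrho _ zr.
  have Hz : cderiv H z (dH z) by have := HDc _ Kz; rewrite cE.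
  have := cderivD (cderivM (cderiv_cst (2%:C * (H zq)^*%C) z) Hz)
    (cderivM (cderiv_cst (2%:C * e%:C * zq^*%C) z) (cderiv_id z)).
  by apply: cderiv_eq => //; rewrite !mulr0 !addr0 mulr1.
have GD' z : 0 < cabs (z - zq) < rho -> cderiv G z (dG z).
  by move=> /andP[_]; exact: GD.
have GB (s : R) : 0 < s -> exists C : R, forall z : R[i],
    s < cabs (z - zq) < rho -> cabs (dG z) <= C.
  move=> _; exists (cabs (2%:C * (H zq)^*%C) * C + cabs (2%:C * e%:C * zq^*%C)).
  move=> z /andP[_ zr]; have Kz := Hrho _ zr.
  apply: (le_trans (cabsD _ _)); rewrite lerD2r cabsM ler_wpM2l ?cabs_ge0//.
  by have := dHC _ Kz; rewrite -/(c _) cE.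
have zqq : cabs (zq - zq) < rho by rewrite subrr cabs0.
have Gc := cderiv_cvg (GD _ zqq).
have rr : 0 < rho / 2 < rho by rewrite divr_gt0//= ltr_pdivrMr// ltr_pMr// ltr1n.
have d0 : 0 < e * (rho / 2) ^+ 2 by rewrite mulr_gt0// exprn_gt0// divr_gt0.
have [z [zr zG]] := weak_maximum GD' GB rr d0 Gc.
have Kz : K (complex.Re z, complex.Im z).
  by apply: Hrho; rewrite zr; case/andP: rr.
have := qmax (complex.Re z, complex.Im z); rewrite inE => /(_ Kz).
rewrite /Phi cE -/zq leNgt => /negP; apply.
have rE : (rho / 2) ^+ 2 = (complex.Re z - complex.Re zq) ^+ 2 + (complex.Im z - complex.Im zq) ^+ 2.
  by rewrite -zr cabs_sqr !(cReD, cImD, cReN, cImN).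
move: zG; rewrite rE !cabs_sqr /G.
move: (zq) (H zq) (H z) e0 => [c1 c2] [b1 b2] [a1 a2] e0; case: (z) => [x y] /=.
have := sqr_ge0 (a1 - b1); have := sqr_ge0 (a2 - b2) => h1 h2 h3.
lra.
Qed.

End complex_derivatives.

(** * Two-constants estimate and derivatives at a boundary point *)

Section bounded_holomorphic.
Variable R : realType.

(** With the derivative and the bound existentially quantified, the class is closed under ring
    operations, so the product fed to the maximum principle never has to be differentiated by
    hand. *)
Definition bounded_holo (K : set (R * R)) (H : R[i] -> R[i]) : Prop :=
  exists (dH : R[i] -> R[i]) (C : R), 0 <= C /\ forall p, K p ->
    [/\ cderiv H (p.1 +i* p.2) (dH (p.1 +i* p.2)), cabs (dH (p.1 +i* p.2)) <= C &
        cabs (H (p.1 +i* p.2)) <= C].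

Lemma bounded_holoM K H G : bounded_holo K H -> bounded_holo K G ->
  bounded_holo K (fun z => H z * G z).
Proof.
move=> [dH [C [C0 HC]]] [dG [B [B0 GB]]].
exists (fun z => H z * dG z + G z * dH z), (2 * C * B + C * B); split.
  by rewrite addr_ge0// !mulr_ge0.
move=> p Kp; have [h1 h2 h3] := HC p Kp; have [g1 g2 g3] := GB p Kp.
split; first exact: cderivM.
- apply: (le_trans (cabsD _ _)); rewrite !cabsM.
  have := ler_pM (cabs_ge0 _) (cabs_ge0 _) h3 g2.
  have := ler_pM (cabs_ge0 _) (cabs_ge0 _) g3 h2.
  by have := mulr_ge0 C0 B0; lra.
- rewrite cabsM.
  have := ler_pM (cabs_ge0 _) (cabs_ge0 _) h3 g3.
  by have := mulr_ge0 C0 B0; lra.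
Qed.

Lemma bounded_holoD K H G : bounded_holo K H -> bounded_holo K G ->
  bounded_holo K (fun z => H z + G z).
Proof.
move=> [dH [C [C0 HC]]] [dG [B [B0 GB]]].
exists (fun z => dH z + dG z), (C + B); split; first by rewrite addr_ge0.
move=> p Kp; have [h1 h2 h3] := HC p Kp; have [g1 g2 g3] := GB p Kp.
split; first exact: cderivD.
- by apply: (le_trans (cabsD _ _)); exact: lerD.
- by apply: (le_trans (cabsD _ _)); exact: lerD.
Qed.

Lemma bounded_holo_cst K c : bounded_holo K (fun=> c).
Proof.
exists (fun=> 0), (cabs c); split; first exact: cabs_ge0.
by move=> p Kp; split; [exact: cderiv_cst|rewrite cabs0 cabs_ge0|].
Qed.

Lemma bounded_holo_id K (N : R) : (forall p, K p -> cabs (p.1 +i* p.2) <= N) ->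
  bounded_holo K id.
Proof.
move=> KN; exists (fun=> 1), (`|N| + 1); split; first by rewrite addr_ge0.
move=> p Kp; split; first exact: cderiv_id.
- by rewrite (_ : 1 = 1%:C)// cabs_real normr1 lerDr.
- by apply: le_trans (KN _ Kp) _; apply: le_trans (ler_norm _) _; rewrite lerDl.
Qed.

Lemma bounded_holoX K H n : bounded_holo K H -> bounded_holo K (fun z => H z ^+ n).
Proof.
move=> KH; elim: n => [|n IH].
  have -> : (fun z => H z ^+ 0) = (fun=> 1) by apply/funext => z; rewrite expr0.
  exact: bounded_holo_cst.
have -> : (fun z => H z ^+ n.+1) = (fun z => H z * H z ^+ n).
  by apply/funext => z; rewrite exprS.
exact: bounded_holoM.
Qed.

Lemma maximum_principle_holo (H : R[i] -> R[i]) (K : set (R * R)) (B N : R) :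
  compact K -> 0 <= B -> bounded_holo K H ->
  (forall p, K p -> cabs (p.1 +i* p.2) <= N) ->
  (forall p, K p -> cabs (H (p.1 +i* p.2)) <= B \/
    exists2 rho, 0 < rho & forall z, cabs (z - (p.1 +i* p.2)) < rho ->
      K (complex.Re z, complex.Im z)) ->
  forall p, K p -> cabs (H (p.1 +i* p.2)) <= B.
Proof.
move=> cK B0 [dH [C [C0 HC]]] KN Kb.
by apply: (@maximum_principle R H dH K B N C) => // p /HC[].
Qed.

End bounded_holomorphic.

(** * An explicit barrier on the half disc *)

Section barrier.
Variable R : realType.

(* The real part of [xi ^+ 2 - 2 'i xi] is nonnegative on the segment [-1, 1],
   at least 1 on the upper unit half circle, and small near 0: powers of
   [barrier] thus play the role of the two-constants theorem in the half disc. *)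
Definition barrier (xi : R[i]) : R[i] :=
  1 - (10^-1)%:C * (xi ^+ 2 - 2%:C * 'i%C * xi).

Lemma barrierE (X Y : R) : cabs (barrier (X +i* Y)) ^+ 2 =
  1 - (X ^+ 2 - Y ^+ 2 + 2 * Y) / 5
    + (X ^+ 2 + Y ^+ 2) * (X ^+ 2 + (Y - 2) ^+ 2) / 100.
Proof. by rewrite cabs_sqr /barrier !expr2/=; field. Qed.

(** In [barrierE] the term [- X ^ 2 / 5] outweighs the contribution of [X] to the last summand, so
    only terms that are small with [Y] remain. *)
Lemma barrier_bottom (X Y eta : R) : 0 <= eta <= 20^-1 -> - eta <= Y <= eta ->
  X ^+ 2 <= 1 -> cabs (barrier (X +i* Y)) <= 1 + eta.
Proof.
move=> /andP[e0 e1] /andP[Y0 Y1] X1.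
rewrite -(@ler_pXn2r _ 2) ?nnegrE ?cabs_ge0 ?addr_ge0// barrierE.
have X0 := sqr_ge0 X.
have Y2 : Y ^+ 2 <= eta ^+ 2 by nra.
have Y20 := sqr_ge0 Y.
have e2 : eta ^+ 2 <= eta / 20 by nra.
have N1 : X ^+ 2 + (Y - 2) ^+ 2 <= 6 by nra.
have N2 : (X ^+ 2 + Y ^+ 2) * (X ^+ 2 + (Y - 2) ^+ 2) <= (X ^+ 2 + Y ^+ 2) * 6.
  by rewrite ler_wpM2l// addr_ge0.
nra.
Qed.

Lemma barrier_circle (X Y : R) : - 20^-1 <= Y -> X ^+ 2 + Y ^+ 2 = 1 ->
  cabs (barrier (X +i* Y)) <= 47 / 50.
Proof.
move=> Y0 XY; rewrite -(@ler_pXn2r _ 2) ?nnegrE ?cabs_ge0 ?divr_ge0//.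
rewrite barrierE.
have Y1 : Y <= 1 by have := sqr_ge0 X; nra.
have -> : X ^+ 2 = 1 - Y ^+ 2 by rewrite -XY addrK.
(* On the circle the squared modulus is a convex quadratic in [Y], so its values at [- 20^-1] and 1
   bound it in between; this product expresses that convexity. *)
have : (Y + 20^-1) * (1 - Y) >= 0 by rewrite mulr_ge0; lra.
nra.
Qed.

(** What matters is [49 / 50 > 47 / 50]: at modulus [1 / 16] the barrier exceeds its bound on the
    arc. The radius is small enough for the crude bound [3 / 80] on the term subtracted in
    [barrierE]. *)
Lemma barrier_inner (X Y : R) : X ^+ 2 + Y ^+ 2 = (16^-1) ^+ 2 ->
  49 / 50 <= cabs (barrier (X +i* Y)).
Proof.
set s : R := 16^-1 => XY.
have s0 : 0 <= s by rewrite invr_ge0.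
have s1 : 16 * s = 1 by rewrite mulfV.
rewrite -(@ler_pXn2r _ 2) ?nnegrE ?cabs_ge0 ?divr_ge0//.
rewrite barrierE.
have X0 := sqr_ge0 X; have Y0 := sqr_ge0 Y.
have Y1 : Y <= s.
  have [//|sY] := leP Y s; have : s ^+ 2 < Y ^+ 2 by rewrite ltrXn2r// (le_trans s0)// ltW.
  lra.
have : 0 <= (X ^+ 2 + Y ^+ 2) * (X ^+ 2 + (Y - 2) ^+ 2).
  by rewrite mulr_ge0// addr_ge0 ?sqr_ge0.
have : s ^+ 2 <= s by rewrite expr2 ler_piMl//; lra.
lra.
Qed.

(** A reversed Bernoulli inequality, [(1 + eta) ^ k * (1 - k * eta) <= 1], is proved by induction on
    [k]. *)
Lemma exp1D_le2 (n : nat) (eta : R) : 0 <= eta -> n%:R * eta <= 2^-1 ->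
  (1 + eta) ^+ n <= 2.
Proof.
move=> e0 ne.
have H k : (k <= n)%N -> (1 + eta) ^+ k * (1 - k%:R * eta) <= 1.
  elim: k => [|k IH] kn; first by rewrite expr0 mul0r subr0 mulr1.
  apply: le_trans (IH (ltnW kn)); rewrite exprSr -mulrA ler_wpM2l ?exprn_ge0 ?addr_ge0//.
  rewrite -natr1; have : 0 <= (k%:R : R) by [].
  nra.
have := H n (leqnn n).
have : 0 <= (1 + eta) ^+ n by rewrite exprn_ge0// addr_ge0.
nra.
Qed.

(** The ratio [47 / 49] of the two barrier bounds is below 1, so a high power beats any constant. *)
Lemma geometric_small (C e : R) : 0 <= C -> 0 < e ->
  exists n : nat, C * (47 / 50) ^+ n <= e * (49 / 50) ^+ n.
Proof.
move=> C0 e0; pose q : R := 47 / 49.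
have q1 : `|q| < 1 by rewrite /q ger0_norm ?divr_ge0// ltr_pdivrMr//; lra.
have := cvg_expr q1 => /cvgrPdist_le /(_ (e / (C + 1))).
have C1 : 0 < C + 1 by rewrite ltr_wpDl.
move=> /(_ (divr_gt0 e0 C1)) [n _ /(_ n (leqnn n))].
rewrite sub0r normrN ger0_norm ?exprn_ge0 ?divr_ge0// => H; exists n.
have -> : (47 / 50 : R) = q * (49 / 50) by rewrite /q; field.
rewrite exprMn mulrA ler_wpM2r ?exprn_ge0 ?divr_ge0//.
apply: (@le_trans _ _ ((C + 1) * q ^+ n)).
  by rewrite ler_wpM2r ?exprn_ge0 ?divr_ge0// lerDl.
by rewrite mulrC -ler_pdivlMr.
Qed.

End barrier.

(** Only the side above the graph is encoded. The side below is brought to this form by the half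
    turn [z -> - z], which replaces [phi] by [fun s => - phi (- s)]. *)
Definition graph_strip (R : realType) (phi : R -> R) (a b q : R) : set R[i] :=
  [set z | a < complex.Re z < b /\
    phi (complex.Re z) < complex.Im z < phi (complex.Re z) + q].

(** The path goes vertically down to the boundary value at [Re z], then along the boundary to [x0];
    both parts are controlled by [cabs (z - z0)]. This is the crude bound on the arc and, with
    [A = 0], continuity of [f] up to the boundary. *)
Lemma boundary_linear_bound (R : realType) (f : R[i] -> R[i]) (gb : R -> R[i])
    (phi : R -> R) (a b q L M' K x0 : R) :
  let U := graph_strip phi a b q in
  let z0 := x0 +i* phi x0 in
  0 <= L -> 0 <= M' -> 0 <= K ->
  (forall x y, `|phi x - phi y| <= L * `|x - y|) ->
  (forall z, U z -> cabs (f z - gb (complex.Re z)) <= M' * (complex.Im z - phi (complex.Re z))) ->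
  (forall x y, a < x < b -> a < y < b -> cabs (gb x - gb y) <= K * `|x - y|) ->
  a < x0 < b -> forall A z, U z ->
  cabs (f z - gb x0 - A * (z - z0)) <= (M' * (1 + L) + K + cabs A) * cabs (z - z0).
Proof.
move=> U z0 L0 M'0 K0 phiL gbf gbL x0ab A z Uz; have [xab yb] := Uz.
have h1 := gbf _ Uz; have h2 := gbL _ _ xab x0ab; have h3 := phiL x0 (complex.Re z).
have r1 : `|complex.Re z - x0| <= cabs (z - z0).
  by have := Re_le_cabs (z - z0); rewrite cReD cReN.
have r2 : `|complex.Im z - phi x0| <= cabs (z - z0).
  by have := Im_le_cabs (z - z0); rewrite cImD cImN.
have -> : f z - gb x0 - A * (z - z0) =
  (f z - gb (complex.Re z)) + (gb (complex.Re z) - gb x0) + (- (A * (z - z0))) by ring.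
apply: (le_trans (cabsD _ _)); rewrite cabsN cabsM mulrDl lerD2r.
apply: (le_trans (cabsD _ _)); rewrite mulrDl; apply: lerD; last first.
  by apply: (le_trans h2); rewrite ler_wpM2l.
apply: (le_trans h1); rewrite -mulrA ler_wpM2l//.
rewrite distrC in h3; rewrite distrC in r1 *.
have h3' : phi x0 - phi (complex.Re z) <= L * cabs (z - z0).
  apply: le_trans (ler_norm _) _; rewrite distrC; apply: (le_trans h3).
  by rewrite ler_wpM2l.
by have := le_trans (ler_norm _) r2; lra.
Qed.

(** The maximum principle is applied to [h * Q ^ n], where [h] is the error and [Q] the barrier
    scaled to radius [r]. On the arc [h] is only of order [r] but [Q ^ n] is tiny; on the lifted
    graph [h] is small and [Q ^ n] at most 2; at [z] the factor is at least [dn]. The value of [A]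
    is forced: along the tangent vector [1 +i* dphi] the derivative must give [alpha]. *)
Lemma boundary_derivative (R : realType) (f df : R[i] -> R[i]) (gb : R -> R[i])
    (phi : R -> R) (a b q L M M' K x0 dphi : R) (alpha : R[i]) :
  let U := graph_strip phi a b q in
  let z0 := x0 +i* phi x0 in
  let A := alpha / (1 +i* dphi) in
  0 < q -> 0 <= L -> 0 <= M' -> 0 <= K ->
  (forall x y, `|phi x - phi y| <= L * `|x - y|) ->
  (forall z, U z -> cderiv f z (df z)) ->
  (forall z, U z -> cabs (df z) <= M) ->
  (forall z, U z -> cabs (f z - gb (complex.Re z)) <= M' * (complex.Im z - phi (complex.Re z))) ->
  (forall x y, a < x < b -> a < y < b -> cabs (gb x - gb y) <= K * `|x - y|) ->
  a < x0 < b -> is_derive x0 1 phi dphi ->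
  (forall e : R, 0 < e -> exists2 d : R, 0 < d & forall x,
    `|x - x0| < d -> cabs (gb x - gb x0 - (x - x0)%:C * alpha) <= e * `|x - x0|) ->
  forall eps : R, 0 < eps ->
  exists2 d : R, 0 < d & forall z, U z -> cabs (z - z0) < d ->
    cabs (f z - gb x0 - A * (z - z0)) <= eps * cabs (z - z0).
Proof.
move=> U z0 A q0 L0 M'0 K0 phiL fD dfM gbf gbL x0ab phiD gbD eps eps0.
pose tau := 1 +i* dphi.
have tau_ge1 : 1 <= cabs tau by rewrite -[leLHS]normr1; exact: (Re_le_cabs tau).
have tau_neq0 : tau != 0 by rewrite -cabs_gt0 (lt_le_trans _ tau_ge1).
have phiC : continuous phi by exact: lipschitz_continuousR phiL.
have bound := boundary_linear_bound L0 M'0 K0 phiL gbf gbL x0ab A.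
pose M1 := M' * (1 + L) + K + cabs A.
have M10 : 0 <= M1 by rewrite !addr_ge0 ?cabs_ge0// mulr_ge0// addr_ge0.
(* [r] will be 16 times [cabs (z - z0)], so [ep * r] is the bound to be proved. *)
pose ep := eps / 16.
have ep0 : 0 < ep by rewrite divr_gt0.
have [n Hn] := geometric_small M10 ep0.
pose dn : R := (49 / 50) ^+ n.
have dn0 : 0 < dn by rewrite exprn_gt0// divr_gt0.
(* The bound [20^-1] is the range of the barrier lemmas; the other one keeps [(1 + eta) ^ n] at most
   2, which explains the half in [e1]. *)
pose eta : R := Num.min 20^-1 (2 * n.+1%:R)^-1.
have eta0 : 0 < eta by rewrite lt_min invr_gt0 ltr0n invr_gt0 mulr_gt0.
have eta1 : eta <= 20^-1 by rewrite ge_min lexx.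
have etan : n%:R * eta <= 2^-1.
  have : eta <= (2 * n.+1%:R)^-1 by rewrite ge_min lexx orbT.
  rewrite invfM => H; apply: (@le_trans _ _ (n.+1%:R * (2^-1 * n.+1%:R^-1))).
    by apply: ler_pM => //; [exact: ltW|rewrite ler_nat].
  by rewrite mulrCA mulfV// mulr1.
pose e1 := ep * dn / 2.
have e10 : 0 < e1 by rewrite divr_gt0// mulr_gt0.
pose cA := cabs A.
have cA0 : 0 <= cA by exact: cabs_ge0.
pose e2 := Num.min (eta / 4) (e1 / (4 * (cA + 1))).
have e20 : 0 < e2 by rewrite lt_min !divr_gt0// mulr_gt0// ltr_wpDl.
have e2eta : e2 <= eta / 4 by rewrite ge_min lexx.
have e2A : cA * e2 <= e1 / 4.
  have : e2 <= e1 / (4 * (cA + 1)) by rewrite ge_min lexx orbT.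
  rewrite ler_pdivlMr ?mulr_gt0 ?ltr_wpDl// => H.
  by rewrite ler_pdivlMr//; clear - H e20; nra.
have [d1 d10 Hd1] := (is_derive_epsP _ _ _).1 phiD _ e20.
have e140 : 0 < e1 / 4 by rewrite divr_gt0.
have [d2 d20 Hd2] := gbD _ e140.
have /andP[ax0 x0b] := x0ab.
pose d3 := Num.min (Num.min d1 d2) (Num.min (Num.min (x0 - a) (b - x0)) (q / (1 + L))).
have L1 : 0 < 1 + L by rewrite ltr_pwDl.
have d30 : 0 < d3 by rewrite !lt_min d10 d20 !subr_gt0 ax0 x0b divr_gt0.
exists (d3 / 16); first by rewrite divr_gt0.
move=> z Uz; rewrite ltr_pdivlMr// => zd.
(* This puts the rescaled [z] at modulus [1 / 16], where [barrier_inner] applies. *)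
pose r := cabs (z - z0) * 16.
have [E|zz0] := eqVneq (cabs (z - z0)) 0.
  by have := bound _ Uz; rewrite E !mulr0.
have cz0 : 0 < cabs (z - z0) by rewrite lt_def zz0 cabs_ge0.
have r0 : 0 < r by rewrite mulr_gt0.
have rd : r < d3 by [].
move: (rd); rewrite !lt_min => /andP[/andP[rd1 rd2] /andP[/andP[ra rb]]].
rewrite ltr_pdivlMr// => rq.
have [xab /andP[zlow zup]] := Uz.
pose s1 := Num.min (eta / 4) (e1 / (4 * (M' + cA + 1))).
have MA1 : 0 < M' + cA + 1 by rewrite ltr_wpDl// addr_ge0.
have s10 : 0 < s1 by rewrite lt_min !divr_gt0// mulr_gt0.
have s1eta : s1 <= eta / 4 by rewrite ge_min lexx.
have s1A : (M' + cA) * s1 <= e1 / 4.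
  have : s1 <= e1 / (4 * (M' + cA + 1)) by rewrite ge_min lexx orbT.
  rewrite ler_pdivlMr ?mulr_gt0// => H.
  by rewrite ler_pdivlMr//; clear - H s10; nra.
(* The lift of the graph: positive, so that the compact set stays inside [U]; not above [z]; and
   small against [r], so that [f] is close to its boundary value on the lifted graph. *)
pose s := Num.min (s1 * r) (complex.Im z - phi (complex.Re z)).
have s0 : 0 < s by rewrite lt_min mulr_gt0// subr_gt0.
have sr : s <= s1 * r by rewrite ge_min lexx.
have sz : s <= complex.Im z - phi (complex.Re z) by rewrite ge_min lexx orbT.
(* The box supplies compactness; [KKP] derives it from the disc condition. *)
pose KK : set (R * R) := (`[x0 - r, x0 + r]%classic `*` `[phi x0 - r, phi x0 + r]%classic)
  `&` [set p | (p.1 - x0) ^+ 2 + (p.2 - phi x0) ^+ 2 <= r ^+ 2 /\ phi p.1 + s <= p.2].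
have sqK x : x ^+ 2 <= r ^+ 2 -> - r <= x <= r.
  move=> xr; rewrite -ler_norml -(@ler_pXn2r _ 2) ?nnegrE ?(ltW r0)//.
  by rewrite real_normK// num_real.
have KKP p : (p.1 - x0) ^+ 2 + (p.2 - phi x0) ^+ 2 <= r ^+ 2 -> phi p.1 + s <= p.2 -> KK p.
  move=> h1 h2; split => //; split; rewrite /= in_itv/=.
    have : (p.1 - x0) ^+ 2 <= r ^+ 2 by have := sqr_ge0 (p.2 - phi x0); clear - h1; lra.
    by move=> /sqK; rewrite -ler_norml ler_distl.
  have : (p.2 - phi x0) ^+ 2 <= r ^+ 2 by have := sqr_ge0 (p.1 - x0); clear - h1; lra.
  by move=> /sqK; rewrite -ler_norml ler_distl.
have KKx p : KK p -> `|p.1 - x0| <= r.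
  by move=> [[]]; rewrite /= !in_itv/= => h _ _; rewrite ler_distl.
have KKy p : KK p -> `|p.2 - phi x0| <= r.
  by move=> [[_]]; rewrite /= !in_itv/= => h _; rewrite ler_distl.
have KKU p : KK p -> U (p.1 +i* p.2).
  move=> Kp; have := KKx p Kp; have := KKy p Kp; have [_ [_ ps]] := Kp.
  have := phiL p.1 x0; rewrite !ler_norml => /andP[p1 _] /andP[_ y2] /andP[x1 x2].
  have : L * `|p.1 - x0| <= L * r by rewrite ler_wpM2l// ler_norml x1.
  move=> Lr; split => /=; first by clear - x1 x2 ra rb; lra.
  by apply/andP; clear - ps s0 p1 Lr y2 rq; split; [lra|nra].
have phi1 p : KK p -> `|phi p.1 - phi x0 - dphi * (p.1 - x0)| <= e2 * r.
  move=> Kp; apply: le_trans (Hd1 _ (le_lt_trans (KKx _ Kp) rd1)) _.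
  by rewrite ler_wpM2l ?(ltW e20)// KKx.
have cKK : compact KK.
  apply: compact_closedI.
    by apply: compact_setX; exact: segment_compact.
  have -> : [set p : R * R | (p.1 - x0) ^+ 2 + (p.2 - phi x0) ^+ 2 <= r ^+ 2 /\ phi p.1 + s <= p.2] =
    (fun p => (p.1 - x0) * (p.1 - x0) + (p.2 - phi x0) * (p.2 - phi x0)) @^-1` [set t | t <= r ^+ 2] `&`
    (fun p => p.2 - phi p.1) @^-1` [set t | t >= s].
    by apply/seteqP; split => p /=; rewrite -!expr2 lerBrDl.
  apply: closedI; apply: closed_comp.
  - move=> p _; apply: cvgD; apply: cvgM; apply: cvgB; try exact: cvg_cst;
      (exact: cvg_fst || exact: cvg_snd).
  - exact: closed_le.
  - move=> p _; apply: cvgB; first exact: cvg_snd.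
    by apply: (continuous_comp (f := fst)); [exact: cvg_fst|exact: phiC].
  - exact: closed_ge.
pose T := cabs tau.
have T0 : 0 < T by rewrite cabs_gt0.
(* [xi] maps the disc of radius [r] about [z0] to the unit disc and the tangent direction [tau] to
   the positive real axis, so the graph stays within [eta] of that axis. *)
pose kap := ((T * r)^-1)%:C * tau^*%C.
pose xi z := kap * (z - z0).
have xiE x y : xi (x +i* y) = (((x - x0) + dphi * (y - phi x0)) / (T * r)) +i*
   (((y - phi x0) - dphi * (x - x0)) / (T * r)).
  by apply: complex_eqP; rewrite /xi /kap /tau /=; ring.
have Tr : cabs tau ^+ 2 = 1 + dphi ^+ 2 by rewrite cabs_sqr/= expr1n.
have xiN x y : (((x - x0) + dphi * (y - phi x0)) / (T * r)) ^+ 2 +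
   (((y - phi x0) - dphi * (x - x0)) / (T * r)) ^+ 2 =
   ((x - x0) ^+ 2 + (y - phi x0) ^+ 2) / r ^+ 2.
  have -> : ((x - x0) ^+ 2 + (y - phi x0) ^+ 2) / r ^+ 2 =
     (1 + dphi ^+ 2) * ((x - x0) ^+ 2 + (y - phi x0) ^+ 2) / (T ^+ 2 * r ^+ 2).
    by rewrite -Tr -/T; field; rewrite !gt_eqF.
  by field; rewrite !gt_eqF.
have Trr : r <= T * r by rewrite ler_peMl// ltW.
have Ylow p : KK p -> - eta <= ((p.2 - phi x0) - dphi * (p.1 - x0)) / (T * r).
  move=> Kp; rewrite ler_pdivlMr ?mulr_gt0//.
  have := phi1 p Kp; rewrite ler_norml => /andP[h _].
  have [_ [_ ps]] := Kp.
  apply: (@le_trans _ _ (- eta * r)); first by rewrite !mulNr lerN2 ler_wpM2l// ltW.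
  by clear - h ps s0 e2eta r0 eta0; nra.
pose h z := f z - gb x0 - A * (z - z0).
pose Q z := barrier (xi z).
pose H z := h z * Q z ^+ n.
pose N := `|x0| + `|phi x0| + 2 * r.
have KN p : KK p -> cabs (p.1 +i* p.2) <= N.
  move=> Kp; apply: (le_trans (cabs_le_ReIm _)) => /=.
  have := KKx p Kp; have := KKy p Kp.
  have := ler_normD (p.1 - x0) x0; have := ler_normD (p.2 - phi x0) (phi x0).
  by rewrite !subrK /N; clear - r0; lra.
have bid := bounded_holo_id KN.
have M1r : 0 <= M1 * r by rewrite mulr_ge0// ltW.
have cAr : 0 <= cA * r by rewrite mulr_ge0// ltW.
have M0 : 0 <= M by apply: le_trans (cabs_ge0 _) (dfM _ Uz).
have bf : bounded_holo KK f.
  exists df, (M + M1 * r + cabs (gb x0) + cA * r); split.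
    by rewrite !addr_ge0// cabs_ge0.
  move=> p Kp; have Up := KKU _ Kp.
  have pr : cabs ((p.1 +i* p.2) - z0) <= r.
    rewrite -(@ler_pXn2r _ 2) ?nnegrE ?cabs_ge0 ?(ltW r0)// cabs_sqr/=.
    by have [_ []] := Kp.
  split; first exact: fD.
  - by apply: (le_trans (dfM _ Up)); have := cabs_ge0 (gb x0); clear - M1r cAr; lra.
  - have -> : f (p.1 +i* p.2) = h (p.1 +i* p.2) + gb x0 + A * (p.1 +i* p.2 - z0).
      by rewrite /h; ring.
    apply: (le_trans (cabsD _ _)); apply: lerD; last by rewrite cabsM ler_wpM2l.
    apply: (le_trans (cabsD _ _)); rewrite lerD2r.
    apply: (le_trans (bound _ Up)).
    by rewrite -/M1; have : M1 * cabs ((p.1 +i* p.2) - z0) <= M1 * r; [rewrite ler_wpM2l|clear - M0; lra].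
have bxi : bounded_holo KK xi.
  apply: bounded_holoM; first exact: bounded_holo_cst.
  by apply: bounded_holoD => //; exact: bounded_holo_cst.
have bh : bounded_holo KK h.
  have -> : h = (fun z => f z + (- gb x0 + - A * (z + - z0))).
    by apply/funext => w; rewrite /h; ring.
  apply: bounded_holoD => //; apply: bounded_holoD; first exact: bounded_holo_cst.
  apply: bounded_holoM; first exact: bounded_holo_cst.
  by apply: bounded_holoD => //; exact: bounded_holo_cst.
have bQ : bounded_holo KK Q.
  have -> : Q = (fun z => 1 + - (10^-1)%:C * (xi z * xi z + - (2%:C * 'i%C) * xi z)).
    by apply/funext => w; rewrite /Q /barrier; ring.
  apply: bounded_holoD; first exact: bounded_holo_cst.
  apply: bounded_holoM; first exact: bounded_holo_cst.
  apply: bounded_holoD; first exact: bounded_holoM.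
  by apply: bounded_holoM => //; exact: bounded_holo_cst.
have bH : bounded_holo KK H by apply: bounded_holoM => //; exact: bounded_holoX.
pose B := ep * r * dn.
have B0 : 0 <= B by rewrite !mulr_ge0// ltW.
have far p : KK p -> (p.1 - x0) ^+ 2 + (p.2 - phi x0) ^+ 2 = r ^+ 2 ->
    cabs (H (p.1 +i* p.2)) <= B.
  move=> Kp pr; rewrite /H cabsM cabsX.
  have hp : cabs (h (p.1 +i* p.2)) <= M1 * r.
    apply: (le_trans (bound _ (KKU _ Kp))).
    rewrite ler_wpM2l// -(@ler_pXn2r _ 2) ?nnegrE ?cabs_ge0 ?(ltW r0)// cabs_sqr/=.
    by rewrite pr.
  have Qp : cabs (Q (p.1 +i* p.2)) <= 47 / 50.
    rewrite /Q xiE; apply: barrier_circle; last by rewrite xiN pr divff// expf_eq0/= gt_eqF.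
    by apply: le_trans (Ylow p Kp); rewrite lerN2.
  apply: (@le_trans _ _ (M1 * r * (47 / 50) ^+ n)).
    apply: ler_pM; rewrite ?cabs_ge0 ?exprn_ge0 ?cabs_ge0//.
    by apply: lerXn2r; rewrite ?nnegrE ?cabs_ge0 ?divr_ge0.
  by rewrite /B mulrAC [leRHS]mulrAC ler_wpM2r// ltW.
have near_ p : KK p -> p.2 = phi p.1 + s -> cabs (H (p.1 +i* p.2)) <= B.
  move=> Kp ps; rewrite /H cabsM cabsX; have Up := KKU _ Kp.
  have px := KKx p Kp; have ph := phi1 p Kp.
  have Qp : cabs (Q (p.1 +i* p.2)) ^+ n <= 2.
    apply: le_trans (exp1D_le2 (ltW eta0) etan).
    apply: lerXn2r; rewrite ?nnegrE ?cabs_ge0 ?addr_ge0 ?(ltW eta0)//.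
    rewrite /Q xiE; apply: barrier_bottom; first by rewrite (ltW eta0).
      rewrite Ylow//= ler_pdivrMr ?mulr_gt0//.
      apply: (@le_trans _ _ (eta * r)); last by rewrite ler_wpM2l// ltW.
      move: ph; rewrite ler_norml => /andP[_ ph]; rewrite ps; clear - ph sr s1eta e2eta r0 eta0; nra.
    apply: (@le_trans _ _ (((p.1 - x0) ^+ 2 + (p.2 - phi x0) ^+ 2) / r ^+ 2)).
      by rewrite -xiN lerDl sqr_ge0.
    by rewrite ler_pdivrMr ?exprn_gt0// mul1r; have [_ []] := Kp.
  have hp : cabs (h (p.1 +i* p.2)) <= e1 * r.
    have pE : p.2 - phi p.1 = s by rewrite ps [LHS]addrC addKr.
    have := gbf _ Up; rewrite /= pE => h1.
    have := Hd2 _ (le_lt_trans px rd2) => h2.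
    (* On the lifted graph [z - z0] is [(x - x0) * tau] plus a purely imaginary deviation, and
       [A * tau = alpha]. *)
    have h3 : cabs ((p.1 - x0)%:C * alpha - A * (p.1 +i* p.2 - z0)) <= cA * (e2 * r + s).
      have -> : (p.1 - x0)%:C * alpha - A * (p.1 +i* p.2 - z0) =
          A * (- 'i%C * (phi p.1 - phi x0 - dphi * (p.1 - x0) + s)%:C).
        have aE : alpha = A * tau by rewrite /A mulfVK.
        have -> : p.1 +i* p.2 - z0 = (p.1 - x0)%:C * tau +
            'i%C * (phi p.1 - phi x0 - dphi * (p.1 - x0) + s)%:C.
          by apply: complex_eqP; rewrite /tau /z0 ps/=; ring.
        by rewrite aE; ring.
      rewrite (cabsM A) (cabsM (- 'i%C)) cabsN cabs_real ler_wpM2l//.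
      have -> : cabs ('i%C : R[i]) = 1 by rewrite cabsE/= expr0n/= expr1n add0r sqrtr1.
      rewrite mul1r; apply: (le_trans (ler_normD _ _)).
      by rewrite (gtr0_norm s0) lerD2r.
    have -> : h (p.1 +i* p.2) = (f (p.1 +i* p.2) - gb p.1) +
      (gb p.1 - gb x0 - (p.1 - x0)%:C * alpha) +
      ((p.1 - x0)%:C * alpha - A * (p.1 +i* p.2 - z0)) by rewrite /h; ring.
    apply: (le_trans (cabsD _ _)).
    apply: (@le_trans _ _ (M' * s + e1 / 4 * r + cA * (e2 * r + s))).
      apply: lerD => //; apply: (le_trans (cabsD _ _)); apply: lerD => //.
      by apply: (le_trans h2); rewrite ler_wpM2l// ltW.
    have : (M' + cA) * s <= e1 / 4 * r.
      apply: le_trans (_ : (M' + cA) * (s1 * r) <= _).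
        by rewrite ler_wpM2l// addr_ge0.
      by rewrite mulrA ler_wpM2r// ltW.
    have : cA * e2 * r <= e1 / 4 * r by rewrite ler_wpM2r// ltW.
    have : 0 <= e1 * r by rewrite mulr_ge0// ltW.
    by clear - r0; lra.
  apply: (@le_trans _ _ (e1 * r * 2)).
    by apply: ler_pM; rewrite ?cabs_ge0 ?exprn_ge0 ?cabs_ge0.
  by rewrite /B /e1 le_eqVlt; apply/orP; left; apply/eqP; field.
have KKz : KK (complex.Re z, complex.Im z).
  apply: KKP => /=; last by clear - sz; lra.
  have -> : (complex.Re z - x0) ^+ 2 + (complex.Im z - phi x0) ^+ 2 = cabs (z - z0) ^+ 2.
    by rewrite cabs_sqr !(cReD, cImD, cReN, cImN).
  by rewrite lerXn2r ?nnegrE ?cabs_ge0 ?(ltW r0)// /r ler_peMr ?cabs_ge0// ler1n.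
have zE : complex.Re z +i* complex.Im z = z by case: (z).
have main : cabs (H z) <= B.
  rewrite -{1}zE.
  apply: (@maximum_principle_holo R H KK B N cKK B0 bH KN _ (complex.Re z, complex.Im z) KKz).
  move=> p Kp; have [_ [pr ps]] := Kp.
  (* Equality in one of the two constraints of [KK] is the arc or the lifted graph. Otherwise both
     have slack, which gives a disc inside [KK]; the slack over the graph is divided by [1 + L]. *)
  have [E|pr'] := eqVneq ((p.1 - x0) ^+ 2 + (p.2 - phi x0) ^+ 2) (r ^+ 2).
    by left; apply: far.
  have [E|ps'] := eqVneq p.2 (phi p.1 + s); first by left; apply: near_.
  right.
  have pp1 : cabs (p.1 +i* p.2 - z0) < r.
    rewrite -(@ltr_pXn2r _ 2) ?nnegrE ?cabs_ge0 ?(ltW r0)// cabs_sqr/=.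
    by rewrite lt_neqAle pr' pr.
  have pp2 : phi p.1 + s < p.2 by rewrite lt_neqAle eq_sym ps' ps.
  exists (Num.min (r - cabs (p.1 +i* p.2 - z0)) ((p.2 - phi p.1 - s) / (1 + L))).
    by rewrite lt_min subr_gt0 pp1/= divr_gt0//; clear - pp2; lra.
  move=> w; rewrite lt_min ltr_pdivlMr// => /andP[w1 w2].
  apply: KKP => /=.
    have -> : (complex.Re w - x0) ^+ 2 + (complex.Im w - phi x0) ^+ 2 = cabs (w - z0) ^+ 2.
      by rewrite cabs_sqr !(cReD, cImD, cReN, cImN).
    rewrite lerXn2r ?nnegrE ?cabs_ge0 ?(ltW r0)//.
    have -> : w - z0 = (w - (p.1 +i* p.2)) + (p.1 +i* p.2 - z0) by rewrite addrA subrK.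
    by apply: (le_trans (cabsD _ _)); clear - w1; lra.
  have := Re_le_cabs (w - (p.1 +i* p.2)); have := Im_le_cabs (w - (p.1 +i* p.2)).
  rewrite !(cReD, cImD, cReN, cImN)/= => i1 i2.
  have := phiL (complex.Re w) p.1 => i3.
  have i4 : L * `|complex.Re w - p.1| <= L * cabs (w - p.1 +i* p.2) by rewrite ler_wpM2l.
  move: i1 (le_trans i3 i4); rewrite !ler_norml => /andP[i1 _] /andP[_ i5].
  by clear - i1 i5 w2; lra.
have Qz : 49 / 50 <= cabs (Q z).
  rewrite -{1}zE /Q xiE; apply: barrier_inner; rewrite xiN.
  have -> : (complex.Re z - x0) ^+ 2 + (complex.Im z - phi x0) ^+ 2 = cabs (z - z0) ^+ 2.
    by rewrite cabs_sqr !(cReD, cImD, cReN, cImN).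
  by rewrite /r; field.
have : cabs (h z) * dn <= ep * r * dn.
  apply: le_trans main; rewrite /H cabsM cabsX ler_wpM2l ?cabs_ge0//.
  by apply: lerXn2r; rewrite ?nnegrE ?cabs_ge0 ?divr_ge0.
rewrite (ler_pM2r dn0) => hz.
have -> : eps * cabs (z - z0) = ep * r by rewrite /ep /r; field.
exact: hz.
Qed.

(** * Consequences at a boundary point *)

Section no_accumulation.
Variable R : realType.

(** If [A] is nonzero, the linear term dominates the error. The case [A = 0] is contradictory in
    itself: Cauchy's estimate at a point straight above [z0], about which a disc comparable to its
    height fits into the strip, makes [df] too small there. *)
Lemma boundary_value_noaccumulation (f df : R[i] -> R[i]) (phi : R -> R)
    (a b q L M m x0 : R) (w0 A : R[i]) :
  let U := graph_strip phi a b q in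
  let z0 := x0 +i* phi x0 in
  0 < q -> 0 <= L -> 0 < m ->
  (forall x y, `|phi x - phi y| <= L * `|x - y|) ->
  (forall z, U z -> cderiv f z (df z)) ->
  (forall z, U z -> m < cabs (df z)) ->
  (forall z, U z -> cabs (df z) <= M) ->
  a < x0 < b ->
  (forall e : R, 0 < e -> exists2 d : R, 0 < d & forall z, U z ->
    cabs (z - z0) < d -> cabs (f z - w0 - A * (z - z0)) <= e * cabs (z - z0)) ->
  exists2 d : R, 0 < d & forall z, U z -> cabs (z - z0) < d -> f z <> w0.
Proof.
move=> U z0 q0 L0 m0 phiL fD dfm dfM /andP[ax0 x0b] est.
have [A0|A0] := eqVneq A 0; last first.
  have cA : 0 < cabs A / 2 by rewrite divr_gt0// cabs_gt0.
  have [d d0 Hd] := est _ cA; exists d => // z Uz zd fz.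
  have := Hd z Uz zd; rewrite fz subrr sub0r cabsN cabsM.
  have z1 : 0 < cabs (z - z0).
    rewrite cabs_gt0 subr_eq0; apply/eqP => E.
    by move: Uz => []; rewrite E/= ltxx => _ /andP[].
  by rewrite ler_pM2r//; lra.
exfalso.
have L1 : 0 < 1 + L by rewrite ltr_pwDl.
(* Chosen so that [e * (3 * t)] equals [m * (rho / 2)]; the contradiction then comes from the strict
   bound on [df z1]. *)
pose e := m / (12 * (1 + L)).
have e0 : 0 < e by rewrite divr_gt0// mulr_gt0.
have [d d0 Hd] := est _ e0.
pose t := Num.min (Num.min (d / 2) (q / 2)) (Num.min (x0 - a) (b - x0)) / 2.
have t0 : 0 < t.
  by rewrite divr_gt0// !lt_min !subr_gt0 ax0 x0b !divr_gt0.
have [td tq ta tb] : [/\ 2 * t <= d / 2, 2 * t <= q / 2, 2 * t <= x0 - a & 2 * t <= b - x0].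
  have -> : 2 * t = Num.min (Num.min (d / 2) (q / 2)) (Num.min (x0 - a) (b - x0)).
    by rewrite /t; field.
  by split; rewrite !ge_min lexx ?orbT.
pose z1 := x0 +i* (phi x0 + t).
(* Within distance [rho] of [z1] the height above the graph changes by at most
   [(1 + L) * rho = t / 2]. *)
pose rho := t / (2 * (1 + L)).
have rho0 : 0 < rho by rewrite divr_gt0// mulr_gt0.
have rhoE : rho * (2 * (1 + L)) = t by rewrite /rho mulfVK// gt_eqF// mulr_gt0.
have rhot : rho <= t / 2.
  have : 0 <= rho * L by rewrite mulr_ge0// ltW.
  lra.
have z10 : cabs (z1 - z0) = t.
  have -> : z1 - z0 = 'i%C * t%:C by apply: complex_eqP; rewrite /=; ring.
  rewrite cabsM cabs_real (gtr0_norm t0).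
  by rewrite cabsE/= expr0n/= expr1n add0r sqrtr1 mul1r.
have BU z : cabs (z - z1) < rho -> U z.
  move=> zr; have := Re_le_cabs (z - z1); have := Im_le_cabs (z - z1).
  rewrite !(cReD, cImD, cReN, cImN)/= => i1 r1.
  have p1 := phiL (complex.Re z) x0.
  have p2 : L * `|complex.Re z - x0| <= L * rho.
    by rewrite ler_wpM2l//; apply: (le_trans r1); exact: ltW.
  move: i1 r1 (le_trans p1 p2); rewrite !ler_norml => /andP[i1 i2] /andP[r1 r2] /andP[p3 p4].
  by split; apply/andP; split; lra.
have Uz1 : U z1 by apply: BU; rewrite subrr cabs0.
have zd z : cabs (z - z1) < rho -> cabs (z - z0) < 3 / 2 * t.
  move=> zr; have -> : z - z0 = (z - z1) + (z1 - z0) by rewrite addrA subrK.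
  by apply: (le_lt_trans (cabsD _ _)); rewrite z10; lra.
have fz z : cabs (z - z1) < rho -> cabs (f z - w0) <= e * (3 / 2 * t).
  move=> zr; have z3 := zd z zr.
  have := Hd z (BU z zr); rewrite A0 mul0r subr0 => H.
  apply: le_trans (H _) _; first by lra.
  by rewrite ler_wpM2l// ltW.
have seg (z : R[i]) (s : R) : cabs (z - z1) < rho -> 0 <= s <= 1 -> cabs (z1 + s%:C * (z - z1) - z1) < rho.
  move=> zr /andP[s0 s1]; rewrite addrC addKr cabsM cabs_real ger0_norm//.
  by apply: le_lt_trans zr; rewrite ler_piMl// cabs_ge0.
have M0 : 0 <= M by apply: le_trans (cabs_ge0 _) (dfM _ Uz1).
have rr : 0 < rho / 2 < rho by rewrite divr_gt0//= ltr_pdivrMr// ltr_pMr// ltr1n.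
have S0 : 0 <= e * (3 * t) by rewrite mulr_ge0 ?(ltW e0)// mulr_ge0 ?(ltW t0).
have := @cauchy_estimate R f df z1 rho (rho / 2) M (e * (3 * t)) rr S0.
have h1 z : cabs (z - z1) < rho -> cderiv f z (df z) by move=> /BU/fD.
have h2 z : cabs (z - z1) < rho -> cabs (df z) <= M by move=> /BU/dfM.
have h3 z : cabs (z - z1) < rho -> cabs (f z - f z1) <= M * cabs (z - z1).
  by move=> zr; apply: (@cabs_segment_le R f df) => s s01; [apply: h1|apply: h2]; exact: seg.
have h4 z : cabs (z - z1) = rho / 2 -> cabs (f z - f z1) <= e * (3 * t).
  move=> zr; have zr' : cabs (z - z1) < rho by rewrite zr; case/andP: rr.
  have z11 : cabs (z1 - z1) < rho by rewrite subrr cabs0.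
  have -> : f z - f z1 = (f z - w0) - (f z1 - w0) by ring.
  apply: (le_trans (cabsD _ _)); rewrite cabsN.
  by have := fz z zr'; have := fz z1 z11; lra.
move=> /(_ h1 h2 h3 h4) H.
have : m * (rho / 2) < e * (3 * t).
  have rho2 : 0 < rho / 2 by case/andP: rr.
  by apply: lt_le_trans H; rewrite (ltr_pM2r rho2); exact: dfm.
have -> : e * (3 * t) = m * (rho / 2) by rewrite -rhoE /e; field; rewrite gt_eqF.
by rewrite ltxx.
Qed.

(** Every [F s - M * s] lies below every [F t + M * t], so the supremum of the former is the limit
    at 0, with its rate. *)
Lemma lipschitz_boundary_limit (F : R -> R) (M q : R) : 0 < q -> 0 <= M ->
  (forall s t, 0 < s < q -> 0 < t < q -> F s - F t <= M * `|s - t|) ->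
  exists l, forall s, 0 < s < q -> `|F s - l| <= M * s.
Proof.
move=> q0 M0 FL.
pose S := [set F s - M * s | s in `]0, q[%classic].
have q2 : 0 < q / 2 < q by rewrite divr_gt0//= ltr_pdivrMr// ltr_pMr// ltr1n.
have S0 : S !=set0 by exists (F (q / 2) - M * (q / 2)); exists (q / 2) => //=; rewrite in_itv.
have Sub t : 0 < t < q -> ubound S (F t + M * t).
  move=> t0 _ [s /=] /[!in_itv]/= s0 <-.
  have := FL s t s0 t0; have /andP[s1 _] := s0; have /andP[t1 _] := t0.
  have : `|s - t| <= s + t by rewrite ler_norml; apply/andP; split; lra.
  move=> h1 h2; have := ler_wpM2l M0 h1; lra.
exists (sup S) => s s0.
have h1 : F s - M * s <= sup S.
  by apply: ub_le_sup; [exists (F (q / 2) + M * (q / 2)); exact: Sub|exists s => //=; rewrite in_itv].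
have h2 : sup S <= F s + M * s by apply: ge_sup => //; exact: Sub.
by rewrite ler_norml; apply/andP; split; lra.
Qed.

End no_accumulation.

(** * Linear content *)

Section hausdorff_null.
Variable R : realType.
Local Notation C := (R[i]^o).

(* Every set is measurable for [plane]: [mu_ext] of [diam] is then the
   1-dimensional Hausdorff content, whose countable subadditivity is that of
   [mu_ext]. *)
Definition plane := g_sigma_algebraType [set: set C].

Definition content1 (A : set plane) : \bar R := mu_ext (@diam R : set plane -> \bar R) A.

Lemma diam_ge0 (A : set C) : (0 <= diam A)%E.
Proof. by apply: ereal_sup_ubound; left. Qed.

Lemma diam_le (A : set C) (d : R) : 0 <= d ->
  (forall z w, A z -> A w -> cabs (z - w) <= d) -> (diam A <= d%:E)%E.
Proof.
move=> d0 Ad; apply: ge_ereal_sup => _ [->|[[z w] [/= Az Aw] <-]].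
  by rewrite lee_fin.
by rewrite lee_fin Ad.
Qed.

Lemma diam0 : diam (set0 : set C) = 0%E.
Proof. by apply/eqP; rewrite eq_le diam_ge0 andbT diam_le. Qed.

Lemma measurable_plane (A : set plane) : measurable A.
Proof. by apply: sub_sigma_algebra. Qed.

Lemma content1_ge0 A : (0 <= content1 A)%E.
Proof. by apply: mu_ext_ge0 => X; exact: diam_ge0. Qed.

Lemma content1_le (A B : set plane) : A `<=` B -> (content1 A <= content1 B)%E.
Proof. exact: le_mu_ext. Qed.

Lemma content1_bigcup (F : nat -> set plane) :
  (forall i, content1 (F i) = 0%E) -> content1 (\bigcup_i F i) = 0%E.
Proof.
move=> F0; apply/eqP; rewrite eq_le content1_ge0 andbT.
apply: (le_trans (mu_ext_sigma_subadditive _ F)); first exact: diam_ge0.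
rewrite [leLHS](_ : _ = 0%E)//; apply: eseries0 => i _ _; exact: F0.
Qed.

(** In a cover of total diameter below [d] each member has diameter below [d], so nullity without a
    size restriction gives it at every scale. *)
Lemma content1_hausdorff1 (A : set C) : content1 A = 0%E -> hausdorff1 A = 0%E.
Proof.
move=> A0.
have H (d : R) : 0 < d -> hausdorff1_delta d A = 0%E.
  move=> d0; apply/eqP; rewrite eq_le; apply/andP; split; last first.
    by apply: le_ereal_inf_tmp => _ [F _ <-]; apply: nneseries_ge0 => i _ _; exact: diam_ge0.
  apply/lee_addgt0Pr => e e0; rewrite add0e.
  have m0 : 0 < Num.min d e by rewrite lt_min d0.
  pose S := [set (\sum_(0 <= k <oo) diam (F k))%E | F in @measurable_cover _ plane A].
  have S0 : ereal_inf S = 0%E := A0.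
  have := @lb_ereal_inf_adherent R S _ m0; rewrite S0 add0e => /(_ isT).
  move=> [_ [F [_ AF] <-] Fm].
  have Fd i : (diam (F i) <= \sum_(0 <= k <oo) diam (F k))%E.
    apply: le_trans (nneseries_lim_ge i.+1 _); last by move=> *; exact: diam_ge0.
    rewrite big_nat_recr//= leeDr// sume_ge0// => *; exact: diam_ge0.
  apply: (@le_trans _ _ (\sum_(0 <= k <oo) diam (F k))%E).
    apply: ereal_inf_lbound; exists F => //; split => // i.
    by apply: le_trans (Fd i) _; apply: (le_trans (ltW Fm)); rewrite lee_fin ge_min lexx.
  by apply: (le_trans (ltW Fm)); rewrite lee_fin ge_min lexx orbT.
apply/eqP; rewrite eq_le; apply/andP; split.
  by apply: ge_ereal_sup => _ [d d0 <-]; rewrite H.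
rewrite -(H 1 ltr01); apply: ereal_sup_ubound; exists 1 => //; exact: ltr01.
Qed.

(** Images of the intervals of a cover of [N] cover the image, each with diameter at most [K] times
    the length; [N] may be any set. *)
Lemma content1_lipschitz_image (G : R -> R[i]) (K : R) (N : set R) : 0 < K ->
  (forall x y, cabs (G x - G y) <= K * `|x - y|) ->
  (content1 (G @` N) <= K%:E * @lebesgue_measure R N)%E.
Proof.
move=> K0 GL; rewrite -lee_pdivrMl//.
apply: le_ereal_inf_tmp => _ [F [mF NF] <-].
rewrite lee_pdivrMl// -nneseriesZl; last first.
  by move=> i _; exact: (wlength_ge0 idfun).
apply: (@le_trans _ _ (\sum_(0 <= k <oo) diam (G @` (F k)))%E).
  apply: ereal_inf_lbound; exists (fun k => G @` (F k)) => //; split.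
    by move=> i; exact: measurable_plane.
  by move=> _ [x /NF[k _ Fx] <-]; exists k => //; exists x.
apply: lee_nneseries => [k _ _|k _]; first exact: diam_ge0.
change (diam (G @` F k) <= K%:E * wlength (@idfun R) (F k))%E.
have /ocitvP[->|[x x12 ->]] := mF k.
  by rewrite wlength0 mule0 image_set0 diam0.
rewrite wlength_itv_bnd; last exact: ltW.
rewrite -EFinM; apply: diam_le; first by rewrite mulr_ge0 ?subr_ge0 ?ltW.
move=> _ _ [s /= s12 <-] [t /= t12 <-]; apply: (le_trans (GL _ _)).
rewrite ler_wpM2l ?(ltW K0)// ler_norml.
by move: s12 t12; rewrite !in_itv/= => /andP[? ?] /andP[? ?]; apply/andP; split; lra.
Qed.

End hausdorff_null.

(** * Boundary values on a graph strip *)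

Section graph_strip_null.
Variable R : realType.
Local Notation mu := (@lebesgue_measure R).

Lemma lipschitz_derivative_le (v : R -> R) (K x l : R) :
  (forall x y, `|v x - v y| <= K * `|x - y|) -> is_derive x 1 v l -> `|l| <= K.
Proof.
move=> vL /is_derive_epsP H; apply/ler_addgt0Pr => e e0.
have [d d0 Hd] := H e e0.
have d2 : 0 < d / 2 by rewrite divr_gt0.
have := Hd (x + d / 2); rewrite [x + _]addrC addrK (gtr0_norm d2).
have -> : d / 2 < d by rewrite ltr_pdivrMr// ltr_pMr// ltr1n.
move=> /(_ isT) h1; have := vL (d / 2 + x) x; rewrite addrK (gtr0_norm d2) => h2.
rewrite -(ler_pM2r d2) -[X in _ * X <= _](gtr0_norm d2) -normrM.
have -> : l * (d / 2) = (v (d / 2 + x) - v x) - (v (d / 2 + x) - v x - l * (d / 2)) by ring.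
by apply: (le_trans (ler_normB _ _)); lra.
Qed.

Lemma maxr_lipschitz (a x y : R) : `|Num.max a x - Num.max a y| <= `|x - y|.
Proof.
have := lexx `|x - y|; rewrite {1}ler_norml => /andP[n1 n2].
have n0 := normr_ge0 (x - y).
by case: (leP a x) => ?; case: (leP a y) => ?; rewrite ler_norml; apply/andP; split; lra.
Qed.

Lemma minr_lipschitz (x y b : R) : `|Num.min x b - Num.min y b| <= `|x - y|.
Proof.
have := lexx `|x - y|; rewrite {1}ler_norml => /andP[n1 n2].
have n0 := normr_ge0 (x - y).
by case: (leP x b) => ?; case: (leP y b) => ?; rewrite ler_norml; apply/andP; split; lra.
Qed.

(** The boundary values are vertical limits of [f]. They are Lipschitz along the graph because [f]
    is so along all vertical translates of the graph, with the common constant [M * (1 + L)]. *)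
Lemma graph_strip_null (f df : R[i] -> R[i]) (phi dphi : R -> R)
    (a b q L M m a' b' : R) :
  let U := graph_strip phi a b q in
  0 < q -> 0 <= L -> 0 < m -> a < a' -> a' < b' -> b' < b ->
  (forall x y, `|phi x - phi y| <= L * `|x - y|) ->
  (forall x, a < x < b -> is_derive x 1 phi (dphi x)) ->
  (forall z, U z -> cderiv f z (df z)) ->
  (forall z, U z -> m < cabs (df z)) ->
  (forall z, U z -> cabs (df z) <= M) ->
  content1 ([set w | exists2 x0, a' < x0 < b' & forall d : R, 0 < d ->
    exists z, [/\ U z, cabs (z - (x0 +i* phi x0)) < d & f z = w]] : set (plane R)) = 0%E.
Proof.
move=> U q0 L0 m0 aa' ab' bb' phiL phiD fD dfm dfM.
have ptU x s : a < x < b -> 0 < s < q -> U (x +i* (phi x + s)).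
  by move=> xab /andP[s0 sq]; split => //=; rewrite ltrDl s0 ltrD2l.
have a'ab : a < a' < b by rewrite aa' (lt_trans ab').
have q2 : 0 < q / 2 < q by rewrite divr_gt0//= ltr_pdivrMr// ltr_pMr// ltr1n.
have M0 : 0 <= M by apply: le_trans (cabs_ge0 _) (dfM _ (ptU _ _ a'ab q2)).
have vert x s t : a < x < b -> 0 < s < q -> 0 < t < q ->
    cabs (f (x +i* (phi x + s)) - f (x +i* (phi x + t))) <= M * `|s - t|.
  move=> xab s0 t0.
  have dE : (x +i* (phi x + s)) - (x +i* (phi x + t)) = 'i%C * (s - t)%:C.
    by apply: complex_eqP; rewrite /=; ring.
  have -> : `|s - t| = cabs ((x +i* (phi x + s)) - (x +i* (phi x + t))).
    by rewrite dE cabsM cabs_real cabsE/= expr0n/= expr1n add0r sqrtr1 mul1r.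
  have sU k : 0 <= k <= 1 ->
      U (x +i* (phi x + t) + k%:C * ((x +i* (phi x + s)) - (x +i* (phi x + t)))).
    move=> /andP[k0 k1]; rewrite dE.
    have -> : x +i* (phi x + t) + k%:C * ('i%C * (s - t)%:C) =
        x +i* (phi x + (t + k * (s - t))) by apply: complex_eqP; rewrite /=; ring.
    apply: ptU => //; move: s0 t0 => /andP[s0 s1] /andP[t0 t1]; apply/andP; split.
      have -> : t + k * (s - t) = (1 - k) * t + k * s by ring.
      have [->|k0'] := eqVneq k 0; first by rewrite subr0 mul1r mul0r addr0.
      by rewrite ltr_wpDl ?mulr_gt0 ?mulr_ge0 ?subr_ge0 ?(ltW t0)// lt_def k0' k0.
    rewrite -subr_gt0.
    have -> : q - (t + k * (s - t)) = (1 - k) * (q - t) + k * (q - s) by ring.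
    have [->|k0'] := eqVneq k 0; first by rewrite subr0 mul1r mul0r addr0 subr_gt0.
    by rewrite ltr_wpDl ?mulr_gt0 ?mulr_ge0 ?subr_ge0 ?subr_gt0 ?(ltW t1)// lt_def k0' k0.
  by apply: (@cabs_segment_le R f df) => k k01; [apply: fD|apply: dfM]; exact: sU.
have graph x y s : a < x < b -> a < y < b -> 0 < s < q ->
    cabs (f (x +i* (phi x + s)) - f (y +i* (phi y + s))) <= M * (1 + L) * `|x - y|.
  wlog yx : x y / y <= x.
    move=> H xab yab s0; have [yx|xy] := leP y x; first exact: H.
    by rewrite cabsB distrC; apply: H => //; exact: ltW.
  move=> /andP[ax xb] /andP[ay yb] s0; rewrite (@ger0_norm _ (x - y)) ?subr_ge0//.
  have tab t : y <= t <= x -> a < t < b.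
    by move=> /andP[yt tx]; rewrite (lt_le_trans ay yt) (le_lt_trans tx xb).
  apply: (@cabs_curve_le R f (fun t => t +i* (phi t + s)) (fun t => df (t +i* (phi t + s)))
    (fun=> 1) dphi) => //.
  - move=> t /tab tt /=.
    have -> : (fun y0 => phi y0 + s) = phi + cst s by apply/funext.
    rewrite -[X in is_derive _ _ _ X]addr0.
    exact: (is_deriveD (phiD _ tt) (is_derive_cst _ _ _)).
  - by move=> t /tab tt; apply: fD; exact: ptU.
  - move=> t /tab tt; rewrite cabsM; apply: ler_pM; rewrite ?cabs_ge0//.
      by apply: dfM; exact: ptU.
    apply: (le_trans (cabs_le_ReIm _)); rewrite /= normr1 lerD2l.
    exact: lipschitz_derivative_le phiL (phiD _ tt).
(* Real and imaginary parts each cost [M], hence [2 * M]; the value 0 outside []a, b[] is a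
   dummy. *)
have [gb gbP] : {gb : R -> R[i] & forall x, a < x < b -> forall s, 0 < s < q ->
    cabs (f (x +i* (phi x + s)) - gb x) <= 2 * M * s}.
  apply: (@choice _ _ (fun x v => a < x < b -> forall s, 0 < s < q ->
    cabs (f (x +i* (phi x + s)) - v) <= 2 * M * s)) => x.
  have [xab|/negP nx] := boolP (a < x < b); last by exists 0.
  have vR s t : 0 < s < q -> 0 < t < q ->
      complex.Re (f (x +i* (phi x + s))) - complex.Re (f (x +i* (phi x + t))) <= M * `|s - t|.
    move=> s0 t0; apply: le_trans (vert x s t xab s0 t0).
    by rewrite -cReN -cReD; apply: le_trans (ler_norm _) (Re_le_cabs _).
  have vI s t : 0 < s < q -> 0 < t < q ->
      complex.Im (f (x +i* (phi x + s))) - complex.Im (f (x +i* (phi x + t))) <= M * `|s - t|.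
    move=> s0 t0; apply: le_trans (vert x s t xab s0 t0).
    by rewrite -cImN -cImD; apply: le_trans (ler_norm _) (Im_le_cabs _).
  have [l1 H1] := lipschitz_boundary_limit q0 M0 vR.
  have [l2 H2] := lipschitz_boundary_limit q0 M0 vI.
  exists (l1 +i* l2) => _ s s0; apply: (le_trans (cabs_le_ReIm _)).
  rewrite cReD cReN cImD cImN /=; have := H1 s s0; have := H2 s s0; lra.
(* The added 1 makes [K] positive, as [content1_lipschitz_image] demands. *)
pose K := M * (1 + L) + 1.
have ML0 : 0 <= M * (1 + L) by rewrite mulr_ge0// addr_ge0.
have K0 : 0 < K by rewrite ltr_wpDl.
have gbL x y : a < x < b -> a < y < b -> cabs (gb x - gb y) <= K * `|x - y|.
  move=> xab yab; apply: (@le_trans _ _ (M * (1 + L) * `|x - y|)); last first.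
    by rewrite ler_wpM2r// lerDl.
  apply/ler_addgt0Pr => e e0.
  pose s := Num.min (q / 2) (e / (4 * (M + 1))).
  have M1 : 0 < 4 * (M + 1) by rewrite mulr_gt0// ltr_wpDl.
  have s0 : 0 < s by rewrite lt_min !divr_gt0.
  have sq : s < q by rewrite gt_min; case/andP: q2 => _ ->.
  have se : 4 * M * s <= e.
    have : s <= e / (4 * (M + 1)) by rewrite ge_min lexx orbT.
    by rewrite ler_pdivlMr//; nra.
  have sI : 0 < s < q by rewrite s0.
  have -> : gb x - gb y = - (f (x +i* (phi x + s)) - gb x) + (f (x +i* (phi x + s)) - f (y +i* (phi y + s)))
     + (f (y +i* (phi y + s)) - gb y) by ring.
  apply: (le_trans (cabsD _ _)).
  have := gbP y yab s sI.
  have := cabsD (- (f (x +i* (phi x + s)) - gb x)) (f (x +i* (phi x + s)) - f (y +i* (phi y + s))).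
  have := gbP x xab s sI; have := graph x y s xab yab sI.
  by rewrite cabsN; lra.
(* Clamping to [[a', b']], inside the open interval where [gb] is controlled, extends the boundary
   function to a Lipschitz function on the whole line. *)
pose cl x := Num.max a' (Num.min x b').
have clE x : a' < x < b' -> cl x = x.
  by move=> /andP[ax xb]; rewrite /cl min_l ?(ltW xb)// max_r// ltW.
have clI x : a < cl x < b.
  by rewrite /cl lt_max aa'/= gt_max (lt_trans ab' bb')/= gt_min bb' orbT.
have clL x y : `|cl x - cl y| <= `|x - y|.
  exact: le_trans (maxr_lipschitz _ _ _) (minr_lipschitz _ _ _).
pose G x := gb (cl x).
have GL x y : cabs (G x - G y) <= K * `|x - y|.
  by apply: (le_trans (gbL _ _ (clI x) (clI y))); rewrite ler_wpM2l ?clL// ltW.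
have GRL x y : `|complex.Re (G x) - complex.Re (G y)| <= K * `|x - y|.
  by apply: le_trans (GL x y); rewrite -cReN -cReD Re_le_cabs.
have GIL x y : `|complex.Im (G x) - complex.Im (G y)| <= K * `|x - y|.
  by apply: le_trans (GL x y); rewrite -cImN -cImD Im_le_cabs.
have [h1 [_ _ HR]] := lipschitz_FTC GRL ab'.
have [h2 [_ _ HI]] := lipschitz_FTC GIL ab'.
(* [B] is a null set containing every parameter of []a', b'[] at which the derivatives [h1] and [h2]
   of the two components of [G] are not both available. *)
have [B [mB B0 HB]] := @filterS2 _ _ (ae_filter_ringOfSetsType mu) _ _
  (fun x => (a' < x < b' -> is_derive x 1 (fun x => complex.Re (G x)) (h1 x)) /\
    (a' < x < b' -> is_derive x 1 (fun x => complex.Im (G x)) (h2 x)))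
  (fun x A B => conj A B) HR HI.
suff WB : [set w | exists2 x0, a' < x0 < b' & forall d : R, 0 < d ->
    exists z, [/\ U z, cabs (z - (x0 +i* phi x0)) < d & f z = w]] `<=` G @` B.
  apply/eqP; rewrite eq_le content1_ge0 andbT.
  apply: (le_trans (content1_le WB)); apply: (le_trans (content1_lipschitz_image B K0 GL)).
  by rewrite [X in (_ * X)%E](_ : _ = 0%E) ?mule0.
have gbf z : U z -> cabs (f z - gb (complex.Re z)) <= 2 * M * (complex.Im z - phi (complex.Re z)).
  move=> [xab yq]; have := gbP _ xab (complex.Im z - phi (complex.Re z)).
  have -> : 0 < complex.Im z - phi (complex.Re z) < q.
    by move: yq => /andP[? ?]; apply/andP; split; lra.
  move=> /(_ isT); rewrite [phi _ + _]addrC subrK.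
  by case: (z).
have M20 : 0 <= 2 * M by rewrite mulr_ge0.
move=> w [x0 x0ab Hw].
have [ax0 x0b] : a' < x0 /\ x0 < b' by case/andP: x0ab.
have x0ab' : a < x0 < b by rewrite (lt_trans aa' ax0) (lt_trans x0b).
have wE : gb x0 = w.
  apply/eqP; rewrite eq_sym -subr_eq0 -cabs_eq0 eq_le cabs_ge0 andbT.
  pose C := 2 * M * (1 + L) + K + cabs (0 : R[i]).
  have C0 : 0 <= C.
    by rewrite /C !addr_ge0 ?cabs_ge0 ?(ltW K0)// mulr_ge0// addr_ge0.
  apply/ler_addgt0Pr => e e0; rewrite add0r.
  have ed : 0 < e / (C + 1) by rewrite divr_gt0// ltr_wpDl.
  have [z [Uz zd <-]] := Hw _ ed.
  have := boundary_linear_bound L0 M20 (ltW K0) phiL gbf gbL x0ab' 0 Uz.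
  rewrite -/C mul0r subr0 => /le_trans; apply.
  rewrite ltr_pdivlMr ?ltr_wpDl// in zd; apply: le_trans (ltW zd).
  by have := cabs_ge0 (z - (x0 +i* phi x0)); lra.
exists x0; last by rewrite /G clE.
apply: HB => /= -[/(_ x0ab) D1 /(_ x0ab) D2].
pose al := h1 x0 +i* h2 x0.
have gbD e : 0 < e -> exists2 d : R, 0 < d & forall x,
    `|x - x0| < d -> cabs (gb x - gb x0 - (x - x0)%:C * al) <= e * `|x - x0|.
  move=> e0; have e20 : 0 < e / 2 by rewrite divr_gt0.
  have [d1 d10 Hd1] := (is_derive_epsP _ _ _).1 D1 _ e20.
  have [d2 d20 Hd2] := (is_derive_epsP _ _ _).1 D2 _ e20.
  exists (Num.min (Num.min d1 d2) (Num.min (x0 - a') (b' - x0))).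
    by rewrite !lt_min d10 d20 !subr_gt0 ax0.
  move=> x; rewrite !lt_min => /andP[/andP[x1 x2] /andP[x3 x4]].
  have xab : a' < x < b'.
    by move: x3 x4; rewrite !ltr_norml => /andP[? ?] /andP[? ?]; apply/andP; split; lra.
  have := Hd1 x x1; have := Hd2 x x2; rewrite /G !clE// => i1 i2.
  apply: (le_trans (cabs_le_ReIm _)).
  have -> : complex.Re (gb x - gb x0 - (x - x0)%:C * al) =
      complex.Re (gb x) - complex.Re (gb x0) - h1 x0 * (x - x0).
    by rewrite !(cReD, cReN, cReM)/=; ring.
  have -> : complex.Im (gb x - gb x0 - (x - x0)%:C * al) =
      complex.Im (gb x) - complex.Im (gb x0) - h2 x0 * (x - x0).
    by rewrite !(cImD, cImN, cImM)/=; ring.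
  lra.
have est := boundary_derivative q0 L0 M20 (ltW K0) phiL fD dfM gbf gbL x0ab' (phiD _ x0ab') gbD.
have [d d0 Hd] := boundary_value_noaccumulation q0 L0 m0 phiL fD dfm dfM x0ab' est.
have [z [Uz zd zw]] := Hw _ d0.
by apply: (Hd z Uz zd); rewrite zw wE.
Qed.

End graph_strip_null.

(** * Smooth Jordan curves as graphs *)

Section plane_topology.
Variable R : realType.

Lemma nbhs_cabsP (z : R[i]^o) (A : set R[i]^o) :
  nbhs z A <-> exists2 r : R, 0 < r & forall w : R[i], cabs (w - z) < r -> A w.
Proof.
split.
  move=> /nbhs_ballP[e /= e0 He].
  have := e0; rewrite ltcE /= => /andP[/eqP ime ree].
  have eE : e = (complex.Re e)%:C by case: (e) ime => ? ? /= ->.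
  exists (complex.Re e) => // w wz; apply: He.
  by rewrite -ball_normE/= distrC normC_cabs eE ltcR.
move=> [r r0 Hr]; apply/nbhs_ballP; exists r%:C => /=; first by rewrite ltcR.
by move=> w; rewrite -ball_normE/= distrC normC_cabs ltcR => /Hr.
Qed.

(** Connectedness of [[0, 1]] in the form of an induction. It serves to walk along a path in a strip
    and to glue local null sets along the parameter interval. *)
Lemma locally_constant_segment (P : R -> Prop) :
  (forall t : R, 0 <= t <= 1 -> exists2 d : R, 0 < d & forall s : R, `|s - t| < d -> P s <-> P t) ->
  P 0 -> P 1.
Proof.
move=> lc P0; have := @segment_connected R 0 1.
pose B := [set t | 0 <= t <= 1 /\ P t].
have key (Q : R -> Prop) : (forall t : R, 0 <= t <= 1 -> exists2 d : R, 0 < d & forall s : R, `|s - t| < d -> Q s <-> Q t) ->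
    exists2 C : set R, open C & [set t | 0 <= t <= 1 /\ Q t] = `[0, 1]%classic `&` C.
  move=> lcQ; exists (\bigcup_(p in [set p : R * R | [/\ 0 <= p.1 <= 1, Q p.1, 0 < p.2 &
      forall s : R, `|s - p.1| < p.2 -> Q s <-> Q p.1]]) [set s | `|s - p.1| < p.2]).
    apply: bigcup_open => p [_ _ p0 _].
    rewrite openE => s /= sp; apply/nbhs_ballP; exists (p.2 - `|s - p.1|) => /=.
      by rewrite subr_gt0.
    move=> t; rewrite -ball_normE/= distrC => ts.
    have := ler_distD s t p.1; lra.
  apply/seteqP; split => t /=.
    move=> [t01 Qt]; split; first by rewrite in_itv.
    have [d d0 Hd] := lcQ t t01; exists (t, d) => /=; first by split.
    by rewrite subrr normr0.
  rewrite in_itv/= => -[t01 [p [p1 p2 p3 p4]]] /= /p4 H.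
  by split=> //; exact/H.
move=> /(_ B) H.
suff : B 1 by case.
rewrite H; first by rewrite /= in_itv/= lexx ler01.
- by exists 0; split => //; rewrite lexx ler01.
- exact: key lc.
- have [|C oC CE] := key (fun t => ~ P t).
    by move=> t /lc[d d0 Hd]; exists d => // s /Hd E; split => nP /E.
  exists (~` C); first exact: open_closedC.
  apply/seteqP; split => t /=.
    move=> [t01 Pt]; split; first by rewrite in_itv.
    move=> Ct; have : (`[0, 1]%classic `&` C) t by split => //=; rewrite in_itv.
    by rewrite -CE => -[].
  rewrite in_itv/= => -[t01 nC]; split => //; apply: contrapT => nP.
  by apply: nC; have : [set t | 0 <= t <= 1 /\ ~ P t] t by []; rewrite CE => -[].
Qed.

(** In the coordinates [Re z] and [Im z - phi (Re z)] the strip is a rectangle, hence convex; the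
    path [h] is a segment in these coordinates. *)
Lemma strip_locally_constant (P : R[i] -> Prop) (phi : R -> R) (a b q L : R) :
  let U := graph_strip phi a b q in 0 <= L ->
  (forall x y, `|phi x - phi y| <= L * `|x - y|) ->
  (forall z, U z -> exists2 r : R, 0 < r & forall w, cabs (w - z) < r -> P w <-> P z) ->
  forall z w, U z -> U w -> P z -> P w.
Proof.
move=> U L0 phiL lc z w Uz Uw Pz.
pose xz := complex.Re z; pose xw := complex.Re w.
pose sz := complex.Im z - phi xz; pose sw := complex.Im w - phi xw.
pose X t := xz + t * (xw - xz).
pose h t := X t +i* (phi (X t) + (sz + t * (sw - sz))).
have h0 : h 0 = z.
  rewrite /h /X !mul0r !addr0 /sz addrC subrK /xz.
  by case: (z).
have h1 : h 1 = w.
  have X1 : X 1 = xw by rewrite /X; ring.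
  have -> : h 1 = xw +i* (phi xw + sw) by rewrite /h X1; congr (_ +i* _); ring.
  rewrite /sw addrC subrK /xw.
  by case: (w).
have hU t : 0 <= t <= 1 -> U (h t).
  move=> /andP[t0 t1]; have [/andP[z1 z2] /andP[z3 z4]] := Uz.
  have [/andP[w1 w2] /andP[w3 w4]] := Uw.
  rewrite -/xz in z1 z2 z3 z4; rewrite -/xw in w1 w2 w3 w4.
  have conv (p r s : R) : p < r -> p < s -> p < r + t * (s - r).
    move=> pr ps; have -> : r + t * (s - r) = p + ((1 - t) * (r - p) + t * (s - p)) by ring.
    rewrite ltrDl; have [->|t0'] := eqVneq t 0.
      by rewrite subr0 mul1r mul0r addr0 subr_gt0.
    by rewrite ltr_wpDl ?mulr_ge0 ?mulr_gt0 ?subr_ge0 ?subr_gt0 ?(ltW pr)// lt_def t0' t0.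
  have conv' (p r s : R) : r < p -> s < p -> r + t * (s - r) < p.
    move=> pr ps; have := @conv (- p) (- r) (- s); rewrite !ltrN2 => /(_ pr ps).
    lra.
  split; rewrite /h/=; first by apply/andP; split; [exact: conv|exact: conv'].
  rewrite ltrDl ltrD2l; apply/andP; split; [apply: conv|apply: conv']; rewrite /sz /sw; lra.
rewrite -h1; apply: (@locally_constant_segment (fun t => P (h t))); last by rewrite h0.
move=> t t01; have [r r0 Hr] := lc _ (hU t t01).
pose V := (1 + L) * `|xw - xz| + `|sw - sz| + 1.
have V0 : 0 < V by rewrite ltr_wpDl// addr_ge0// mulr_ge0// addr_ge0.
exists (r / V); first by rewrite divr_gt0.
move=> s st; apply: Hr; apply: (le_lt_trans (cabs_le_ReIm _)).
have XE : X s - X t = (s - t) * (xw - xz) by rewrite /X; ring.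
rewrite cReD cReN cImD cImN /h/= XE.
have := phiL (X s) (X t); rewrite XE !normrM => pL.
have -> : phi (X s) + (sz + s * (sw - sz)) - (phi (X t) + (sz + t * (sw - sz))) =
  (phi (X s) - phi (X t)) + (s - t) * (sw - sz) by ring.
have := ler_normD (phi (X s) - phi (X t)) ((s - t) * (sw - sz)); rewrite normrM => pD.
move: st; rewrite ltr_pdivlMr// => st; apply: le_lt_trans st.
have := normr_ge0 (s - t); rewrite /V; lra.
Qed.

Lemma cderiv_scale (f : R[i] -> R[i]) (c z l : R[i]) : cabs c = 1 ->
  cderiv f (z * c) l -> cderiv (fun w => f (w * c)) z (l * c).
Proof.
move=> c1 /cderivP H; apply/cderivP => e e0; have [d d0 Hd] := H e e0.
exists d => // w wd; have := Hd (w * c).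
rewrite -mulrBl cabsM c1 mulr1 => /(_ wd).
by have -> : l * ((w - z) * c) = l * c * (w - z) by ring.
Qed.

(** A point off the boundary is interior to [D] or off its closure, so membership in [D] is locally
    constant on the rotated strip. If the strip misses [D], the set is empty; otherwise
    [graph_strip_null] applies to [fun z => f (z * c)]. *)
Lemma one_side_null (D : set R[i]^o) (f df : R[i] -> R[i]) (c : R[i]) (phi dphi : R -> R)
    (a b q L M m a' b' : R) :
  let U := graph_strip phi a b q in
  cabs c = 1 -> open D ->
  (forall z, U z -> ~ boundary D (z * c)) ->
  (forall z, D z -> cderiv f z (df z)) ->
  (forall z, D z -> m < cabs (df z)) ->
  (forall z, D z -> cabs (df z) <= M) ->
  0 < q -> 0 <= L -> 0 < m -> a < a' -> a' < b' -> b' < b ->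
  (forall x y, `|phi x - phi y| <= L * `|x - y|) ->
  (forall x, a < x < b -> is_derive x 1 phi (dphi x)) ->
  content1 ([set w | exists2 x0, a' < x0 < b' & forall d : R, 0 < d ->
    exists z, [/\ U z /\ D (z * c), cabs (z - (x0 +i* phi x0)) < d & f (z * c) = w]]
    : set (plane R)) = 0%E.
Proof.
move=> U c1 oD Ub fD dfm dfM q0 L0 m0 aa' ab' bb' phiL phiD.
have lc z : U z -> exists2 r : R, 0 < r & forall w, cabs (w - z) < r -> D (w * c) <-> D (z * c).
  move=> Uz; have wzc w : cabs (w * c - z * c) = cabs (w - z).
    by rewrite -mulrBl cabsM c1 mulr1.
  have [cD|ncD] := pselect (closure D (z * c)).
    have iD : interior D (z * c) by apply: contrapT => niD; exact: Ub Uz _.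
    have /nbhs_cabsP[r r0 Hr] := iD; exists r => // w wz.
    split => _; last by apply: Hr; rewrite wzc.
    by apply: Hr; rewrite wzc subrr cabs0.
  have : nbhs (z * c : R[i]^o) (~` closure D).
    by apply: open_nbhs_nbhs; split => //; apply: closed_openC; exact: closed_closure.
  move=> /nbhs_cabsP[r r0 Hr]; exists r => // w wz.
  by split => H; exfalso; [apply: (Hr (w * c)); [rewrite wzc|exact: subset_closure]
    |apply: ncD; exact: subset_closure].
have [[z0 [Uz0 Dz0]]|nD] := pselect (exists z, U z /\ D (z * c)); last first.
  apply/eqP; rewrite eq_le content1_ge0 andbT.
  have -> : (0%E = content1 (\bigcup_(i : nat) (set0 : set (plane R))))%E.
    apply/esym/content1_bigcup => i; apply/eqP; rewrite eq_le content1_ge0 andbT.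
    by rewrite /content1 mu_ext0//; [exact: diam0|move=> X; exact: diam_ge0].
  apply: content1_le => w [x0 _ /(_ 1 ltr01)[z [UD _ _]]].
  by exfalso; apply: nD; exists z.
have UD z : U z -> D (z * c).
  by move=> Uz; apply: (strip_locally_constant (P := fun z => D (z * c)) L0 phiL lc Uz0 Uz Dz0).
have H := @graph_strip_null R (fun z => f (z * c)) (fun z => df (z * c) * c) phi dphi
  a b q L M m a' b' q0 L0 m0 aa' ab' bb' phiL phiD.
apply/eqP; rewrite eq_le content1_ge0 andbT -H.
- by apply: content1_le => w [x0 x0ab Hw]; exists x0 => // d /Hw[z [[Uz _] zd fz]]; exists z.
- by move=> z Uz; apply: cderiv_scale => //; apply: fD; exact: UD.
- by move=> z Uz; rewrite cabsM c1 mulr1; apply: dfm; exact: UD.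
- by move=> z Uz; rewrite cabsM c1 mulr1; apply: dfM; exact: UD.
Qed.

End plane_topology.

Section curves.
Variable R : realType.

(** As [dx] is at least [kap > 0], [x] has an inverse [psi] on the window, Lipschitz with constant
    [kap^-1]; the graph function is [y \o psi]. *)
Lemma curve_graph (x y dx dy : R -> R) (t0 eta kap Y : R) :
  0 < eta -> 0 < kap ->
  (forall t, `|t - t0| <= eta -> is_derive t 1 x (dx t)) ->
  (forall t, `|t - t0| <= eta -> is_derive t 1 y (dy t)) ->
  (forall t, `|t - t0| <= eta -> kap <= dx t) ->
  (forall t, `|t - t0| <= eta -> `|dy t| <= Y) ->
  exists phi dphi : R -> R, exists L : R, [/\ 0 <= L,
    forall s t, `|phi s - phi t| <= L * `|s - t|,
    forall s, x (t0 - eta) < s < x (t0 + eta) -> is_derive s 1 phi (dphi s),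
    forall t, `|t - t0| <= eta -> phi (x t) = y t &
    x (t0 - eta) < x t0 < x (t0 + eta) /\
    forall s, x (t0 - eta) <= s <= x (t0 + eta) -> exists2 t, `|t - t0| <= eta & x t = s].
Proof.
move=> eta0 kap0 xD yD dxk dyY.
have seg s t r : `|s - t0| <= eta -> `|t - t0| <= eta -> s <= r <= t -> `|r - t0| <= eta.
  by rewrite !ler_norml => /andP[? ?] /andP[? ?] /andP[? ?]; apply/andP; split; lra.
have xmono s t : `|s - t0| <= eta -> `|t - t0| <= eta -> s <= t -> kap * (t - s) <= x t - x s.
  move=> s0 t0' st.
  have D r : s <= r <= t -> is_derive r 1 (fun r => - x r) (- dx r).
    by move=> /(seg _ _ _ s0 t0')/xD H; exact: is_deriveN.
  have B r : s <= r <= t -> - dx r <= - kap.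
    by move=> /(seg _ _ _ s0 t0')/dxk; rewrite lerN2.
  by have := mean_value_le st D B; lra.
have ylip s t : `|s - t0| <= eta -> `|t - t0| <= eta -> s <= t -> `|y t - y s| <= Y * (t - s).
  move=> s0 t0' st; rewrite ler_norml; apply/andP; split.
    have D r : s <= r <= t -> is_derive r 1 (fun r => - y r) (- dy r).
      by move=> /(seg _ _ _ s0 t0')/yD H; exact: is_deriveN.
    have B r : s <= r <= t -> - dy r <= Y.
      by move=> /(seg _ _ _ s0 t0')/dyY; apply: le_trans; rewrite -normrN ler_norm.
    by have := mean_value_le st D B; lra.
  have D r : s <= r <= t -> is_derive r 1 y (dy r) by move=> /(seg _ _ _ s0 t0')/yD.
  have B r : s <= r <= t -> dy r <= Y.
    by move=> /(seg _ _ _ s0 t0')/dyY; apply: le_trans; rewrite ler_norm.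
  exact: mean_value_le st D B.
have e1 : `|t0 - eta - t0| <= eta by rewrite addrC addKr normrN gtr0_norm.
have e2 : `|t0 + eta - t0| <= eta by rewrite addrC addKr gtr0_norm.
have e0 : `|t0 - t0| <= eta by rewrite subrr normr0 ltW.
have x0 : x (t0 - eta) < x t0 < x (t0 + eta).
  have h1 := xmono _ _ e1 e0; have h2 := xmono _ _ e0 e2.
  have := mulr_gt0 kap0 eta0; move: h1 h2.
  rewrite gerBl lerDl (ltW eta0) => /(_ isT) h1 /(_ isT) h2 h3.
  by apply/andP; split; lra.
set a := x (t0 - eta) in x0 *; set b := x (t0 + eta) in x0 *.
pose cl s := Num.max a (Num.min s b).
have ab : a < b by case/andP: x0 => /lt_trans; apply.
have clI s : a <= cl s <= b.
  by rewrite /cl le_max lexx/= ge_max (ltW ab)/= ge_min lexx orbT.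
have clE s : a <= s <= b -> cl s = s.
  by move=> /andP[as_ sb]; rewrite /cl min_l// max_r.
have clL s t : `|cl s - cl t| <= `|s - t|.
  exact: le_trans (maxr_lipschitz _ _ _) (minr_lipschitz _ _ _).
(* Inverting at the clamped argument extends [psi], hence [phi], by constants outside the window, so
   that it is Lipschitz on the whole line. *)
have [psi psiP] : {psi : R -> R & forall s, `|psi s - t0| <= eta /\ x (psi s) = cl s}.
  apply: (@choice _ _ (fun s t => `|t - t0| <= eta /\ x t = cl s)) => s.
  have le12 : t0 - eta <= t0 + eta by lra.
  have cx : {within `[t0 - eta, t0 + eta], continuous x}.
    apply: derivable_within_continuous => t; rewrite in_itv/= => /andP[h1 h2].
    have : `|t - t0| <= eta by rewrite ler_norml; apply/andP; split; lra.
    by move=> /xD[].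
  have [|t] := @IVT _ x _ _ (cl s) le12 cx.
    by rewrite -/a -/b min_l ?(ltW ab)// max_r ?(ltW ab)// clI.
  rewrite in_itv/= => /andP[h1 h2] xt; exists t; split => //.
  by rewrite ler_norml; apply/andP; split; lra.
have psiL s t : `|psi s - psi t| <= kap^-1 * `|s - t|.
  wlog ts : s t / psi t <= psi s.
    by move=> H; have [/H//|/ltW/H] := leP (psi t) (psi s); rewrite distrC (distrC t).
  have [s1 s2] := psiP s; have [t1 t2] := psiP t.
  have := xmono _ _ t1 s1 ts; rewrite s2 t2 => H.
  rewrite ger0_norm ?subr_ge0// ler_pdivlMl//; apply: (le_trans H).
  exact: le_trans (ler_norm _) (clL s t).
have Y0 : 0 <= Y by apply: le_trans (normr_ge0 _) (dyY _ e0).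
have ylip' s t : `|s - t0| <= eta -> `|t - t0| <= eta -> `|y s - y t| <= Y * `|s - t|.
  move=> s0 t0'; have [st|ts] := leP s t.
    by rewrite distrC (distrC s) (@ger0_norm _ (t - s)) ?subr_ge0//; exact: ylip.
  by rewrite (@ger0_norm _ (s - t)) ?subr_ge0 ?(ltW ts)//; apply: ylip => //; exact: ltW.
have psix t : `|t - t0| <= eta -> psi (x t) = t.
  move=> tt; have [p1 p2] := psiP (x t).
  have xab : a <= x t <= b.
    move: (tt); rewrite ler_norml => /andP[h1 h2]; apply/andP; split.
      have := xmono _ _ e1 tt; have -> : t0 - eta <= t by lra.
      have h3 : 0 <= kap * (t - (t0 - eta)) by apply: mulr_ge0; [exact: ltW|lra].
      by move=> /(_ isT); rewrite -/a; lra.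
    have := xmono _ _ tt e2; have -> : t <= t0 + eta by lra.
    have h3 : 0 <= kap * (t0 + eta - t) by apply: mulr_ge0; [exact: ltW|lra].
    by move=> /(_ isT); rewrite -/b; lra.
  rewrite clE// in p2; apply/eqP; rewrite -subr_eq0 -normr_eq0 eq_le normr_ge0 andbT.
  have [h|/ltW h] := leP (psi (x t)) t.
    have := xmono _ _ p1 tt h; rewrite p2 subrr pmulr_rle0// => h'.
    by rewrite ler0_norm; lra.
  have := xmono _ _ tt p1 h; rewrite p2 subrr pmulr_rle0// => h'.
  by rewrite ger0_norm; lra.
exists (y \o psi), (fun s => dy (psi s) / dx (psi s)), (Y / kap); split => //.
- by rewrite divr_ge0// ltW.
- move=> s t /=; have [s1 _] := psiP s; have [t1 _] := psiP t.
  by apply: (le_trans (ylip' _ _ s1 t1)); rewrite -mulrA ler_wpM2l.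
- move=> s sab; have [s1 s2] := psiP s.
  have dx0 : 0 < dx (psi s) by exact: lt_le_trans (dxk _ s1).
  have sab' : a <= s <= b by case/andP: sab => /ltW -> /ltW ->.
  rewrite clE// in s2.
  apply/is_derive_epsP => e e00.
  pose A := dy (psi s); pose B := dx (psi s); rewrite -/A -/B.
  pose Q := `|A / B| + 1.
  have Q0 : 0 < Q by rewrite ltr_wpDl.
  (* The linearization errors of [y] and of [x] enter with factors at most [Q], and
     [kap * |psi t - psi s| <= |t - s|]. *)
  have ee : 0 < e * kap / (2 * Q) by rewrite divr_gt0 ?mulr_gt0.
  have [d1 d10 H1] := (is_derive_epsP _ _ _).1 (xD _ s1) _ ee.
  have [d2 d20 H2] := (is_derive_epsP _ _ _).1 (yD _ s1) _ ee.
  have /andP[sa sb] := sab.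
  exists (Num.min (Num.min (d1 * kap) (d2 * kap)) (Num.min (s - a) (b - s))).
    by rewrite !lt_min !mulr_gt0//= !subr_gt0 sa sb.
  move=> t; rewrite !lt_min => /andP[/andP[t1 t2] /andP[t3 t4]] /=.
  have tab : a <= t <= b.
    by move: t3 t4; rewrite !ltr_norml => /andP[? ?] /andP[? ?]; apply/andP; split; lra.
  have [u1 u2] := psiP t; rewrite clE// in u2.
  have pl := psiL t s.
  have p1 : `|psi t - psi s| < d1.
    by apply: (le_lt_trans pl); rewrite ltr_pdivrMl// mulrC.
  have p2 : `|psi t - psi s| < d2.
    by apply: (le_lt_trans pl); rewrite ltr_pdivrMl// mulrC.
  have h1 := H1 _ p1; have h2 := H2 _ p2; rewrite u2 s2 in h1.
  rewrite -/B in h1 dx0; rewrite -/A in h2.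
  have -> : y (psi t) - y (psi s) - A / B * (t - s) =
    (y (psi t) - y (psi s) - A * (psi t - psi s)) - A / B * (t - s - B * (psi t - psi s)).
    by field; rewrite gt_eqF.
  apply: (le_trans (ler_normB _ _)); rewrite normrM.
  set E := e * kap / (2 * Q) in ee h1 h2.
  apply: (@le_trans _ _ (Q * (E * `|psi t - psi s|) + Q * (E * `|psi t - psi s|))).
    have EP : 0 <= E * `|psi t - psi s| by rewrite mulr_ge0// ltW.
    apply: lerD; last by apply: ler_pM => //; rewrite /Q lerDl.
    by apply: (le_trans h2); rewrite ler_peMl// /Q lerDr.
  have -> : Q * (E * `|psi t - psi s|) + Q * (E * `|psi t - psi s|) = e * (kap * `|psi t - psi s|).
    by rewrite /E; field; rewrite gt_eqF.
  rewrite ler_wpM2l ?(ltW e00)//.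
  by move: pl; rewrite -ler_pdivrMl ?invr_gt0// invrK.
- by move=> t tt /=; rewrite psix.
- split => // s sab; have [s1 s2] := psiP s; exists (psi s) => //.
  by rewrite s2 clE.
Qed.

End curves.

(** * From the Jordan curve to graph strips *)

Section jordan_curve.
Variable R : realType.
Implicit Types (D : set R[i]^o) (f df : R[i] -> R[i]) (g : R -> R[i]).

Lemma periodic_int g : (forall t, g (t + 1) = g t) ->
  forall (n : int) t, g (t + n%:~R) = g t.
Proof.
move=> gp; have N (n : nat) t : g (t + n%:R) = g t.
  elim: n t => [|n IH] t; first by rewrite addr0.
  by rewrite -natr1 addrA gp IH.
case=> n t; first exact: N.
by rewrite NegzE rmorphN/=; have := N n.+1 (t - n.+1%:R); rewrite subrK => ->.
Qed.

(** By injectivity modulo the period and compactness of the remaining parameters, the curve keeps a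
    positive distance from [g t0] away from [t0]: no remote arc comes back near this point. *)
Lemma curve_separation g (t0 eta : R) : 0 < eta -> 2 * eta < 1 ->
  continuous (fun t => complex.Re (g t)) -> continuous (fun t => complex.Im (g t)) ->
  (forall t, g (t + 1) = g t) -> {in `[0, 1[ &, injective g} ->
  exists2 rho : R, 0 < rho & forall t, cabs (g t - g t0) < rho ->
    exists2 t', `|t' - t0| <= eta & g t' = g t.
Proof.
move=> eta0 eta1 cR cI gp gi; have gn := periodic_int gp.
pose F t := (complex.Re (g t) - complex.Re (g t0)) * (complex.Re (g t) - complex.Re (g t0)) +
  (complex.Im (g t) - complex.Im (g t0)) * (complex.Im (g t) - complex.Im (g t0)).
have FE t : F t = cabs (g t - g t0) ^+ 2.
  by rewrite cabs_sqr !(cReD, cReN, cImD, cImN) !expr2.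
have cF : continuous F.
  by move=> t; apply: cvgD; apply: cvgM; apply: cvgB; (exact: cvg_cst || exact: cR || exact: cI).
have le12 : t0 + eta <= t0 + 1 - eta by lra.
have [c cI' cmin] := @EVT_min _ F _ _ le12 (continuous_subspaceT cF).
have Fc : 0 < F c.
  rewrite FE exprn_gt0// cabs_gt0 subr_eq0; apply/eqP => gc.
  have fl (s : R) : s - (Num.floor s)%:~R \in `[0, 1[.
    have := floor_itv s; rewrite rmorphD/= => /andP[s1 s2].
    by rewrite in_itv/=; apply/andP; split; lra.
  have gfl s : g (s - (Num.floor s)%:~R) = g s by rewrite -(rmorphN (intr : int -> R)) gn.
  have := gi _ _ (fl c) (fl t0); rewrite !gfl gc => /(_ erefl) E.
  (* Equal values would make [c - t0] an integer strictly between 0 and 1. *)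
  have nE : c - t0 = (Num.floor c - Num.floor t0)%:~R by rewrite rmorphB/=; lra.
  move: cI'; rewrite in_itv/= => /andP[c1 c2].
  have n0 : (0 : R) < (Num.floor c - Num.floor t0)%:~R by rewrite -nE; lra.
  have n1 : (Num.floor c - Num.floor t0)%:~R < (1 : R) by rewrite -nE; lra.
  rewrite -[X in X < _](mulr0z (1 : R)) ltr_int in n0.
  rewrite -[X in _ < X](mulr1z (1 : R)) ltr_int in n1.
  by move: n0 n1; case: (Num.floor c - Num.floor t0) => [[|[|k]]|k].
(* [F] is a squared distance. A distance below 1 is at least its own square, which is then below
   [F c] too. *)
exists (Num.min 1 (F c)); first by rewrite lt_min ltr01.
move=> t; rewrite lt_min => /andP[t1 tF].
(* The shifted parameter [s] falls into [[t0 - eta, t0 + 1 - eta[]. *)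
pose n := Num.floor (t - t0 + eta); pose s := t - n%:~R.
have gs : g s = g t by rewrite /s -(rmorphN (intr : int -> R)) gn.
have := floor_itv (t - t0 + eta); rewrite -/n rmorphD/= => /andP[n1 n2].
exists s => //; rewrite ler_norml; apply/andP; split; first by rewrite /s; lra.
rewrite leNgt; apply/negP => ss.
have : s \in `[t0 + eta, t0 + 1 - eta].
  by rewrite in_itv/=; apply/andP; split; rewrite /s in ss *; lra.
move=> /cmin; rewrite (FE s) gs leNgt => /negP; apply.
apply: le_lt_trans tF; by rewrite expr2 ler_piMr ?cabs_ge0// ltW.
Qed.

Lemma content1U (A B : set (plane R)) : content1 A = 0%E -> content1 B = 0%E ->
  content1 (A `|` B) = 0%E.
Proof.
move=> A0 B0; apply/eqP; rewrite eq_le content1_ge0 andbT.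
have <- : content1 (\bigcup_i (if i is 0%N then A else B)) = 0%E.
  by apply: content1_bigcup => -[].
by apply: content1_le => z [Az|Bz]; [exists 0%N|exists 1%N].
Qed.

Lemma content1_sub (A B : set (plane R)) : A `<=` B -> content1 B = 0%E -> content1 A = 0%E.
Proof.
by move=> AB B0; apply/eqP; rewrite eq_le content1_ge0 andbT -B0; exact: content1_le.
Qed.

Definition accumulation_values D f g (I : set R) : set (plane R) :=
  [set w | exists2 t, I t & forall d : R, 0 < d ->
    exists z, [/\ D z, cabs (z - g t) < d & f z = w]].

Lemma smooth_is_derive (x : R -> R) : smooth x -> forall t : R, is_derive t 1 x (derive1 x t).
Proof. by move=> sx t; apply: DeriveDef; [exact: (sx 0%N)|rewrite derive1E]. Qed.

Lemma smooth_derive1_continuous (x : R -> R) : smooth x -> continuous (derive1 x).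
Proof. by move=> sx t; exact/differentiable_continuous/derivable1_diffP/(sx 1%N). Qed.

(** After a rotation the curve near [g t0] is a graph over its tangent, and by [curve_separation] no
    other arc enters the surrounding box, so both strips avoid the boundary. Points of [D] near the
    curve lie in one of them, as the graph itself consists of boundary points. *)
Lemma accumulation_values_local D f df (g : R -> R[i]^o) (m M t0 : R) :
  open D -> smooth_jordan_param g -> boundary D = range g -> 0 < m ->
  (forall z, D z -> cderiv f z (df z)) ->
  (forall z, D z -> m < cabs (df z)) -> (forall z, D z -> cabs (df z) <= M) ->
  exists2 theta : R, 0 < theta &
    content1 (accumulation_values D f g [set t | `|t - t0| < theta]) = 0%E.
Proof.
move=> oD [[sX sY] gp gi gv] bD m0 fD dfm dfM.
set X := (fun t => complex.Re (g t)) in sX gv.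
set Y := (fun t => complex.Im (g t)) in sY gv.
have XD := smooth_is_derive sX; have YD := smooth_is_derive sY.
have cX' := smooth_derive1_continuous sX; have cY' := smooth_derive1_continuous sY.
set v : R[i] := (derive1 X t0) +i* (derive1 Y t0).
have v0 : 0 < cabs v by rewrite cabs_gt0; exact: gv.
(* Multiplication by [u] turns the velocity [v] into the positive number [cabs v], so [x] increases
   near [t0]. *)
pose u := (cabs v)^-1%:C * v^*%C.
have u1 : cabs u = 1.
  by rewrite /u cabsM cabs_real cabs_conj gtr0_norm ?invr_gt0// mulVf// gt_eqF.
have u0 : u != 0 by rewrite -cabs_gt0 u1.
pose G t : R[i] := u * g t.
pose x t := complex.Re (G t); pose y t := complex.Im (G t).
have xE : x = (complex.Re u \*: X) + ((- complex.Im u) \*: Y).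
  by apply/funext => t; rewrite /x /G cReM -mulNr.
have yE : y = (complex.Re u \*: Y) + (complex.Im u \*: X).
  by apply/funext => t; rewrite /y /G cImM.
pose dx t := complex.Re u * derive1 X t + (- complex.Im u) * derive1 Y t.
pose dy t := complex.Re u * derive1 Y t + complex.Im u * derive1 X t.
have xD (t : R) : is_derive t 1 x (dx t).
  by rewrite xE; apply: is_deriveD; exact: is_deriveZ.
have yD (t : R) : is_derive t 1 y (dy t).
  by rewrite yE; apply: is_deriveD; exact: is_deriveZ.
have cM (k : R) (F : R -> R) : continuous F -> continuous (fun t => k * F t).
  by move=> cF t; apply: cvgM; [exact: cvg_cst|exact: cF].
have cdx : continuous dx by move=> t; exact: cvgD (cM _ _ cX' t) (cM _ _ cY' t).
have cdy : continuous dy by move=> t; exact: cvgD (cM _ _ cY' t) (cM _ _ cX' t).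
have dx0 : dx t0 = cabs v.
  have -> : dx t0 = complex.Re (u * v) by rewrite cReM /v/= /dx mulNr.
  have -> : u * v = (cabs v)%:C.
    have vv : v^*%C * v = (cabs v ^+ 2)%:C.
      by rewrite cabs_sqr /v/=; apply: complex_eqP; rewrite /=; ring.
    rewrite /u -mulrA vv; apply: complex_eqP => /=; last by rewrite mulr0 mul0r addr0.
    by rewrite mul0r subr0 expr2 mulKf// gt_eqF.
  by [].
have v2 : 0 < cabs v / 2 by rewrite divr_gt0.
have near_pt (F : R -> R) e : continuous F -> 0 < e ->
    exists2 d : R, 0 < d & forall t, `|t - t0| < d -> `|F t - F t0| < e.
  move=> cF e0; have /cvgrPdist_lt /(_ _ e0) /nbhs_ballP[d /= d0 Hd] := cF t0.
  exists d => // t tt; rewrite distrC; apply: Hd.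
  by rewrite -ball_normE/= distrC.
have [d1 d10 Hd1] := near_pt _ _ cdx v2.
have [d2 d20 Hd2] := near_pt _ _ cdy ltr01.
pose eta := Num.min (Num.min (d1 / 2) (d2 / 2)) 4^-1.
have eta0 : 0 < eta by rewrite !lt_min !divr_gt0//= invr_gt0.
have [etad1 etad2 eta1] : [/\ eta < d1, eta < d2 & 2 * eta < 1].
  have : eta <= d1 / 2 by rewrite !ge_min lexx.
  have : eta <= d2 / 2 by rewrite !ge_min lexx orbT.
  have : eta <= 4^-1 by rewrite ge_min lexx orbT.
  by clear - d10 d20; move=> *; split; lra.
have dxk t : `|t - t0| <= eta -> cabs v / 2 <= dx t.
  move=> tt; have := Hd1 t (le_lt_trans tt etad1); rewrite dx0 ltr_norml => /andP[h _].
  lra.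
have dyY t : `|t - t0| <= eta -> `|dy t| <= `|dy t0| + 1.
  move=> tt; have := Hd2 t (le_lt_trans tt etad2).
  by have := ler_normD (dy t - dy t0) (dy t0); rewrite subrK; lra.
have [phi [dphi [L [L0 phiL phiD phix [/andP[ax xb] surj]]]]] :=
  curve_graph eta0 v2 (fun t _ => xD t) (fun t _ => yD t) dxk dyY.
have cx : continuous x by move=> t; exact: is_derive_continuous (xD t).
have cy : continuous y by move=> t; exact: is_derive_continuous (yD t).
have Gp t : G (t + 1) = G t by rewrite /G gp.
have Gi : {in `[0, 1[ &, injective G}.
  by move=> s t s01 t01 /(mulfI u0); exact: gi.
have [rho rho0 Hrho] := curve_separation t0 eta0 eta1 cx cy Gp Gi.
have L1 : 0 < 1 + L by rewrite ltr_pwDl.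
pose x0 := x t0.
(* In the box of half-width [r1] and half-height [q] around the graph, the distance to [G t0] is
   below [(1 + L) * r1 + q <= rho / 2], within reach of [curve_separation]. *)
pose r1 := Num.min (Num.min (x0 - x (t0 - eta)) (x (t0 + eta) - x0)) (rho / (4 * (1 + L))).
have r10 : 0 < r1 by rewrite !lt_min !subr_gt0 ax xb divr_gt0// mulr_gt0.
have [r1a r1b r1L] : [/\ r1 <= x0 - x (t0 - eta), r1 <= x (t0 + eta) - x0 & (1 + L) * r1 <= rho / 4].
  split; [by rewrite !ge_min lexx|by rewrite !ge_min lexx orbT|].
  have : r1 <= rho / (4 * (1 + L)) by rewrite ge_min lexx orbT.
  by rewrite ler_pdivlMr ?mulr_gt0//; lra.
pose q := rho / 4.
have q0 : 0 < q by rewrite divr_gt0.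
have t00 : `|t0 - t0| <= eta by rewrite subrr normr0 ltW.
have phix0 : phi x0 = y t0 by exact: phix.
have GE t : G t = x t +i* y t by rewrite /x /y; case: (G t).
have on_curve z : `|complex.Re z - x0| < r1 -> `|complex.Im z - phi (complex.Re z)| < q ->
    boundary D (z * u^-1) -> complex.Im z = phi (complex.Re z).
  move=> zx zy; rewrite bD => -[t _ gt].
  have zE : z = G t by rewrite /G gt mulrCA mulfV// mulr1.
  have [|t' tt' Gt'] := Hrho t.
    rewrite -zE; apply: (le_lt_trans (cabs_le_ReIm _)).
    rewrite (GE t0) cReD cReN cImD cImN/= -/x0 -phix0.
    have := ler_normD (complex.Im z - phi (complex.Re z)) (phi (complex.Re z) - phi x0).
    rewrite addrA subrK => h1; have h2 := phiL (complex.Re z) x0.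
    have h3 : L * `|complex.Re z - x0| <= L * r1 by rewrite ler_wpM2l// ltW.
    by rewrite /q in zy; clear - zx zy h1 h2 h3 r1L rho0; lra.
  by rewrite zE -Gt' (GE t')/= phix.
have graph_in_D s : x (t0 - eta) <= s <= x (t0 + eta) -> D ((s +i* phi s) * u^-1) -> False.
  move=> /surj[t tt xt] Dz.
  have E : (s +i* phi s) * u^-1 = g t.
    by rewrite -xt phix// -GE /G mulrAC mulfV// mul1r.
  have : boundary D (g t) by rewrite bD; exists t.
  move=> [_]; apply; rewrite -E.
  by apply: open_nbhs_nbhs.
have r12 : 0 < r1 / 2 by rewrite divr_gt0.
have [th1 th10 Hth] := near_pt _ _ cx r12.
pose theta := Num.min th1 eta.
exists theta; first by rewrite lt_min th10.
have uV1 : cabs u^-1 = 1 by rewrite cabsV u1 invr1.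
have [x1 x2] : x0 - r1 < x0 - r1 / 2 /\ x0 + r1 / 2 < x0 + r1 by clear - r10; split; lra.
have x3 : x0 - r1 / 2 < x0 + r1 / 2 by clear - r10; lra.
pose Up := graph_strip phi (x0 - r1) (x0 + r1) q.
pose psi s := - phi (- s).
pose Lo := graph_strip psi (- (x0 + r1)) (- (x0 - r1)) q.
have Upb z : Up z -> ~ boundary D (z * u^-1).
  move=> [/andP[z1 z2] /andP[z3 z4]] /on_curve H.
  have : complex.Im z = phi (complex.Re z).
    by apply: H; rewrite ltr_distl ?z1//; clear - z3 z4 q0; apply/andP; split; lra.
  by move=> E; move: z3; rewrite E ltxx.
have Lob z : Lo z -> ~ boundary D (z * (- u^-1)).
  rewrite mulrN -mulNr => -[/andP[z1 z2]]; rewrite /psi => /andP[z3 z4] /on_curve H.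
  have : - complex.Im z = phi (- complex.Re z).
    by rewrite -cImN -cReN; apply: H; rewrite cReN ?cImN ltr_norml;
      clear - z1 z2 z3 z4 q0; apply/andP; split; lra.
  by move=> E; move: z3; rewrite -E opprK ltxx.
have phiD' s : x0 - r1 < s < x0 + r1 -> is_derive s 1 phi (dphi s).
  by move=> /andP[s1 s2]; apply: phiD; clear - s1 s2 r1a r1b; apply/andP; split; lra.
have psiL s t : `|psi s - psi t| <= L * `|s - t|.
  have := phiL (- s) (- t); rewrite /psi.
  by rewrite -opprD normrN -opprD normrN.
have psiD s : - (x0 + r1) < s < - (x0 - r1) -> is_derive s 1 psi (dphi (- s)).
  move=> /andP[s1 s2]; have H : x0 - r1 < - s < x0 + r1.
    by clear - s1 s2; apply/andP; split; lra.
  apply/is_derive_epsP => e e0; have [d d0 Hd] := (is_derive_epsP _ _ _).1 (phiD' _ H) _ e0.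
  exists d => // r rs; have := Hd (- r); rewrite -opprD normrN => /(_ rs).
  have -> : psi r - psi s - dphi (- s) * (r - s) =
      - (phi (- r) - phi (- s) - dphi (- s) * - (r - s)) by rewrite /psi; ring.
  by rewrite normrN.
have WUp := one_side_null uV1 oD Upb fD dfm dfM q0 L0 m0 x1 x3 x2 phiL phiD'.
have [y1 y2] : - (x0 + r1) < - (x0 + r1 / 2) /\ - (x0 - r1 / 2) < - (x0 - r1) by clear - r10; split; lra.
have y3 : - (x0 + r1 / 2) < - (x0 - r1 / 2) by clear - r10; lra.
have uV1' : cabs (- u^-1) = 1 by rewrite cabsN.
have WLo := one_side_null uV1' oD Lob fD dfm dfM q0 L0 m0 y1 y3 y2 psiL psiD.
apply: content1_sub (content1U WUp WLo) => w [t /= tt Hw].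
move: tt; rewrite lt_min => /andP[/Hth tx teta].
rewrite -/x0 in tx.
have [xt1 xt2] : x0 - r1 / 2 < x t /\ x t < x0 + r1 / 2.
  by move: tx; rewrite ltr_distl => /andP[].
have phit : phi (x t) = y t by apply: phix; exact: ltW.
(* If at some scale [d0] the value [w] is not taken above the graph, then at all smaller scales it
   is taken below. *)
have [HU|nU] := pselect (forall d : R, 0 < d -> exists z, [/\ Up z /\ D (z * u^-1),
    cabs (z - (x t +i* phi (x t))) < d & f (z * u^-1) = w]).
  by left; exists (x t) => //; rewrite xt1.
right; exists (- x t); first by rewrite !ltrN2 xt1 xt2.
move/existsNP: nU => [d0 /not_implyP[d00 nU]] d d_gt0.
pose d' := Num.min (Num.min d d0) (Num.min (r1 / 2) (q / (1 + L))).
have d'0 : 0 < d' by rewrite !lt_min d_gt0 d00 r12 divr_gt0.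
have [z [Dz]] := Hw _ d'0.
rewrite !lt_min => /andP[/andP[zd zd0] /andP[zr]]; rewrite ltr_pdivlMr// => zq fz.
pose ze := z * u.
have zeV : ze * u^-1 = z by rewrite /ze mulfK.
have zeG : cabs (ze - (x t +i* y t)) = cabs (z - g t).
  by rewrite -GE /G /ze [u * _]mulrC -mulrBl cabsM u1 mulr1.
have rz : `|complex.Re ze - x t| <= cabs (z - g t).
  by rewrite -zeG; have := Re_le_cabs (ze - (x t +i* y t)); rewrite cReD cReN.
have iz : `|complex.Im ze - y t| <= cabs (z - g t).
  by rewrite -zeG; have := Im_le_cabs (ze - (x t +i* y t)); rewrite cImD cImN.
have rz0 : `|complex.Re ze - x0| < r1.
  have := ler_normD (complex.Re ze - x t) (x t - x0); rewrite addrA subrK.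
  by clear - rz zr tx; lra.
have pz : `|complex.Im ze - phi (complex.Re ze)| < q.
  have := ler_normD (complex.Im ze - y t) (phi (x t) - phi (complex.Re ze)).
  rewrite phit addrA subrK => h1.
  have h2 := phiL (x t) (complex.Re ze); rewrite phit distrC in h2.
  have h3 : L * `|x t - complex.Re ze| <= L * cabs (z - g t).
    by rewrite ler_wpM2l// distrC.
  rewrite (distrC (y t)) in h1; clear - h1 h2 h3 iz zq; lra.
have zegr : complex.Im ze != phi (complex.Re ze).
  apply/eqP => E; apply: (graph_in_D (complex.Re ze)).
    move: rz0; rewrite ltr_distl => /andP[h1 h2].
    by clear - h1 h2 r1a r1b; apply/andP; split; lra.
  have zeE : complex.Re ze +i* complex.Im ze = ze by case: (ze).
  by rewrite -E zeE zeV.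
move: rz0 pz; rewrite !ltr_distl => /andP[e1 e2] /andP[e3 e4].
have [ltU|ltL|E] := ltgtP (phi (complex.Re ze)) (complex.Im ze).
- exfalso; apply: nU; exists ze; split.
  + by split; [split; apply/andP|rewrite zeV].
  + by rewrite phit zeG.
  + by rewrite zeV.
- exists (- ze); split.
  + split; last by rewrite mulrNN zeV.
    rewrite /Lo /graph_strip /= cReN cImN /psi opprK !ltrN2 e1 e2 ltL; split => //.
    by rewrite addrC -opprB ltrN2.
  + rewrite /psi opprK phit.
    have -> : - ze - (- x t +i* - y t) = - (ze - (x t +i* y t)).
      by apply: complex_eqP; rewrite /= !(cReN, cReD, cImN, cImD)/=; ring.
    by rewrite cabsN zeG.
  + by rewrite mulrNN zeV.
- by move: zegr; rewrite E eqxx.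
Qed.

End jordan_curve.

(** * Accumulation values *)

(** [P t] concerns the values accumulated along [[0, t]]. By the local lemma it is locally constant
    in [t], which replaces a finite subcover; periodicity reduces every parameter to [[0, 1]]. *)
Lemma accumulation_values_global (R : realType) (D : set R[i]^o) (f df : R[i] -> R[i])
    (g : R -> R[i]^o) (m M : R) :
  open D -> smooth_jordan_param g -> boundary D = range g -> 0 < m ->
  (forall z, D z -> cderiv f z (df z)) ->
  (forall z, D z -> m < cabs (df z)) -> (forall z, D z -> cabs (df z) <= M) ->
  content1 (accumulation_values D f g setT) = 0%E.
Proof.
move=> oD jg bD m0 fD dfm dfM.
have loc t0 := accumulation_values_local t0 oD jg bD m0 fD dfm dfM.
pose P (t : R) := content1 (accumulation_values D f g [set s | 0 <= s <= t]) = 0%E.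
have P1 : P 1.
  apply: locally_constant_segment => [t t01|]; last first.
    have [th th0] := loc 0; apply: content1_sub => w [s /= /andP[s0 s1] Hw].
    exists s => //=; have -> : s = 0 by apply/eqP; rewrite eq_le s0 s1.
    by rewrite subrr normr0.
  have [th th0 Hth] := loc t; exists th => // s st.
  have step a b : `|a - t| < th -> `|b - t| < th -> P a -> P b.
    move=> at_ bt Pa; apply: content1_sub (content1U Pa Hth) => w [r /= /andP[r0 rb] Hw].
    have [ra|ar] := leP r a; first by left; exists r => //=; rewrite r0.
    right; exists r => //=; move: at_ bt; rewrite !ltr_distl => /andP[? ?] /andP[? ?].
    by apply/andP; split; lra.
  have tt : `|t - t| < th by rewrite subrr normr0.
  by split; exact: step.
case: jg => _ gp _ _; have gn := periodic_int gp.
apply: content1_sub P1 => w [t _ Hw].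
have := floor_itv t; rewrite rmorphD/= => /andP[t1 t2].
exists (t - (Num.floor t)%:~R) => /=; first by apply/andP; split; lra.
by rewrite -(rmorphN (intr : int -> R)) gn.
Qed.

Lemma cderiv_isolated (R : realType) (f : R[i] -> R[i]) (z l : R[i]) :
  cderiv f z l -> l != 0 ->
  exists2 d : R, 0 < d & forall w, cabs (w - z) < d -> f w = f z -> w = z.
Proof.
move=> /cderivP fz l0; have l1 : 0 < cabs l by rewrite cabs_gt0.
have l2 : 0 < cabs l / 2 by rewrite divr_gt0.
have [d d0 Hd] := fz _ l2; exists d => // w wz fw.
have := Hd _ wz; rewrite fw subrr sub0r cabsN cabsM -subr_le0 -mulrBl => H.
apply/eqP; rewrite -subr_eq0 -cabs_eq0 eq_le cabs_ge0 andbT.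
by rewrite -(@ler_pM2l _ (cabs l / 2))// mulr0; apply: le_trans H; lra.
Qed.

(** Bolzano-Weierstrass through the filter of sets containing all but finitely many points of [S]:
    it is proper as [S] is infinite, and it clusters in a compact box. *)
Lemma infinite_set_cluster (R : realType) (S : set R[i]) (N : R) :
  infinite_set S -> (forall z, S z -> cabs z <= N) ->
  exists p : R[i], forall d : R, 0 < d -> infinite_set (S `&` [set z | cabs (z - p) < d]).
Proof.
move=> Si SN.
pose K : set (R * R)%type := `[- N, N]%classic `*` `[- N, N]%classic.
have cK : compact K by apply: compact_setX; exact: segment_compact.
pose pr (z : R[i]) : R * R := (complex.Re z, complex.Im z).
pose F : set_system (R * R) := [set A | finite_set (S `&` [set z | ~ A (pr z)])].
have FF : ProperFilter F.
  apply: Build_ProperFilter_ex.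
    move=> A FA; apply: contrapT => /forallNP nA; apply: Si.
    by apply: sub_finite_set FA => z Sz; split => //=; exact: nA.
  split.
  - by apply: sub_finite_set (@finite_set0 _) => z [_ /=]; apply.
  - move=> A B FA FB; apply: (@sub_finite_set _ _ ((S `&` [set z | ~ A (pr z)]) `|` (S `&` [set z | ~ B (pr z)]))).
      by move=> z [Sz /= /not_andP[nA|nB]]; [left|right].
    by rewrite finite_setU.
  - move=> A B AB; apply: sub_finite_set => z [Sz nB]; split => // Az; exact/nB/AB.
have FK : F K.
  apply: sub_finite_set (@finite_set0 _) => z [Sz /=]; apply.
  by split; rewrite /= in_itv/= -ler_norml; apply: le_trans (SN z Sz); [exact: Re_le_cabs|exact: Im_le_cabs].
have [p [_ clp]] := cK F FF FK.
exists (p.1 +i* p.2) => d d0 fin.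
have d2 : 0 < d / 2 by rewrite divr_gt0.
pose A := [set q : R * R | ~ cabs ((q.1 +i* q.2) - (p.1 +i* p.2)) < d].
have FA : F A.
  apply: sub_finite_set fin => z [Sz /= /contrapT zd]; split => //=.
  by move: zd; case: (z).
have [|[x y] [/= Axy [/= xp yp]]] := clp A [set q | ball p.1 (d / 2) q.1 /\ ball p.2 (d / 2) q.2] FA.
  by exists (ball p.1 (d / 2), ball p.2 (d / 2)) => //=; split; exact: nbhsx_ballx.
apply: Axy; apply: (le_lt_trans (cabs_le_ReIm _)); rewrite cReD cReN cImD cImN/=.
move: xp yp; rewrite -!ball_normE /= (distrC p.1) (distrC p.2) => xp yp.
by lra.
Qed.

Lemma infinite_valence_accumulation (R : realType) (D : set R[i]^o) (f df : R[i] -> R[i])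
    (g : R -> R[i]^o) (N : R) (w : R[i]) :
  (forall z, D z -> cabs z <= N) -> boundary D = range g ->
  (forall z, D z -> cderiv f z (df z)) -> (forall z, D z -> df z != 0) ->
  infinite_set (D `&` f @^-1` [set w]) -> accumulation_values D f g setT w.
Proof.
move=> DN bD fD df0 /infinite_set_cluster /(_ (fun z Sz => DN z Sz.1)) [p Hp].
have near (d : R) : 0 < d -> exists z, [/\ D z, f z = w & cabs (z - p) < d].
  by move=> /Hp/infinite_setN0[z [[Dz fz] zp]]; exists z.
(* Inside [D] continuity would give [f p = w], and the nonzero derivative would isolate [p] in its
   fibre. *)
have nDp : ~ D p.
  move=> Dp; have fp : f p = w.
    apply/eqP; rewrite eq_sym -subr_eq0 -cabs_eq0 eq_le cabs_ge0 andbT.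
    have [d d0 Hd] := (cderivP _ _ _).1 (fD _ Dp) 1 ltr01.
    have l1 : 0 < 1 + cabs (df p) by rewrite ltr_pwDl ?cabs_ge0.
    apply/ler_addgt0Pr => e e0; rewrite add0r.
    have [|z [Dz fz]] := near (Num.min d (e / (1 + cabs (df p)))).
      by rewrite lt_min d0 divr_gt0.
    rewrite lt_min ltr_pdivlMr// => /andP[/Hd]; rewrite fz mul1r => h1 h2.
    have := cabsD (w - f p - df p * (z - p)) (df p * (z - p)); rewrite subrK cabsM.
    by lra.
  have [d d0 Hd] := cderiv_isolated (fD _ Dp) (df0 _ Dp).
  apply: Hp d0 _; apply: (@sub_finite_set _ _ [set p]); last exact: finite_set1.
  by move=> z [[_ /= fz] zp]; apply: Hd => //; rewrite fz fp.
have : boundary D p.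
  split; last by move=> /interior_subset.
  move=> B /nbhs_cabsP[r r0 Hr]; have [z [Dz _ zp]] := near _ r0.
  by exists z; split => //; exact: Hr.
rewrite bD => -[t _ tp]; exists t => // d /near [z [Dz fz zp]].
by exists z; rewrite tp.
Qed.

Theorem theoremB (R : realType) (D : set R[i]^o) (f : R[i]^o -> R[i]^o)
    (m M : R) :
  smoothly_bounded_jordan_domain D ->
  analytic_on D f ->
  0 < m -> m < M ->
  derive1 f @` D `<=` annulus m M ->
  hausdorff1 (infinite_valence_values D f) = 0%E.
Proof.
move=> [[_ oD _] [N0 [_ HN]] [g jg bD]] fa m0 _ fm.
have fD z : D z -> cderiv f z (derive1 f z) by move=> /fa; exact: cderiv_derive1.
have dfmM z : D z -> m < cabs (derive1 f z) < M by move=> Dz; apply: fm; exists z.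
have dfm z : D z -> m < cabs (derive1 f z) by move=> /dfmM /andP[].
have dfM z : D z -> cabs (derive1 f z) <= M by move=> /dfmM /andP[_ /ltW].
(* The bound [N0] provided by [bounded_set] lives in [R[i]]; its real part is the bound on
   [cabs]. *)
have DN z : D z -> cabs z <= complex.Re (N0 + 1).
  have /HN H : N0 < N0 + 1 by rewrite ltrDl.
  by move=> Dz; have : `|z| <= N0 + 1 := H z Dz; rewrite lecE => /andP[].
apply/content1_hausdorff1.
apply: content1_sub (accumulation_values_global oD jg bD m0 fD dfm dfM) => w [_].
apply: infinite_valence_accumulation DN bD fD _ => z /dfm.
by rewrite -cabs_gt0; exact: lt_trans.
Qed.
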